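(* Let $G$ be a bounded Jordan domain whose boundary $\Gamma$ is in the class $C(2,\alpha)$ with $\alpha>1/2$. If $\mu_1=s|_\Gamma$ is the arclength measure on $\Gamma$ and $\mu_2=A|_G$ is the area measure on $G$, then $\mu_0=\mu_1+\mu_2$ is a polynomially small (PS) perturbation of $\mu_1$.
   Context: A Jordan curve $\Gamma$ is $C(p,\alpha)$-smooth (in the class $C(p,\alpha)$) if it has an arclength parametrization that is $p$ times differentiable and whose $p$-th derivative belongs to the class $\mathrm{Lip}\,\alpha$, $0<\alpha<1$. For a finite Borel measure $\mu$ on $\mathbb{C}$ with compact infinite support, $p_n(\mu,z)=\gamma_n(\mu)z^n+\cdots$, $\gamma_n(\mu)>0$, denote the orthonormal polynomials for the inner product $\langle f,g\rangle_\mu=\int f\overline{g}\,d\mu$. $\mu_0=\mu_1+\mu_2$ is a polynomially small (PS) perturbation of $\mu_1$ if $\mu_2$ is not the zero measure and $\lim_{n\to\infty}\|p_n(\mu_1,\cdot)\|_{L^2(\mu_2)}=0$. *)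

(* Defs.v *)
From HB Require Import structures.
From mathcomp Require Import all_boot all_order all_algebra.
From mathcomp Require Import all_classical all_reals all_analysis.
From mathcomp Require Import measurable_realfun complex.

Set Implicit Arguments.
Unset Strict Implicit.
Unset Printing Implicit Defensive.

Import Order.TTheory GRing.Theory Num.Theory.
Import numFieldNormedType.Exports.

Local Open Scope classical_set_scope.
Local Open Scope ring_scope.

(* The complex plane as a measurable, topological and normed space is the
   product of two copies of the Borel line; its product sigma-algebra is the
   Borel sigma-algebra. A point of the plane is turned into a complex number of
   R[i] by toC. The norm `|_| of the product is the sup norm, so Euclidean
   distances are always written with cdist. *)
Notation plane R := (measurableTypeR R * measurableTypeR R)%type.

Definition toC (R : realType) (z : plane R) : R[i] := Complex z.1 z.2.

Definition cdist (R : realType) (z w : plane R) : R :=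
  Normc.normc (toC z - toC w).

Section curves.
Context {R : realType}.
Implicit Types (L a b alpha : R) (gamma : R -> plane R) (Gamma G : set (plane R)).

(* Length of the polygon inscribed in gamma at the points a :: s; compare
   [variation] for real-valued functions. *)
Definition polygon_length gamma a b (s : seq R) : R :=
  let F := gamma \o nth b (a :: s) in
  \sum_(0 <= n < size s) cdist (F n.+1) (F n).

Definition arc_length gamma a b : \bar R :=
  ereal_sup [set (polygon_length gamma a b s)%:E | s in itv_partition a b].

(* Closed curves are L-periodic functions on the whole line, so that regularity
   of gamma includes regularity at the point where the curve closes up. *)
Definition jordan_parametrization L gamma Gamma :=
  [/\ 0 < L,
      continuous gamma,
      forall t, gamma (t + L) = gamma t,
      {in `[0, L[ &, injective gamma} &
      range gamma = Gamma].

Definition arclength_parametrization L gamma Gamma :=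
  jordan_parametrization L gamma Gamma /\
  forall a b, a <= b -> arc_length gamma a b = (b - a)%:E.

(* p times differentiable, with p-th derivative in Lip alpha. *)
Definition C_smooth (p : nat) alpha gamma :=
  (forall k t, (k < p)%N -> derivable (derive1n k gamma) t 1) /\
  exists K : R, forall s t,
    cdist (derive1n p gamma s) (derive1n p gamma t) <= K * `|s - t| `^ alpha.

Definition boundary G : set (plane R) := closure G `\` interior G.

(* G is a bounded domain whose boundary is Gamma; it is a Jordan domain when
   Gamma is a Jordan curve, that is, has a jordan_parametrization. *)
Definition bounded_domain_with_boundary G Gamma :=
  [/\ open G, G !=set0, connected G, bounded_set G & boundary G = Gamma].

End curves.

Section measurability.
Context {R : realType}.

Lemma open_measurable_plane (G : set (plane R)) : open G -> measurable G.
Proof.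
move=> oG.
pose B (i : rat * rat * nat) : set (plane R) :=
  (ball (ratr i.1.1 : R) i.2.+1%:R^-1) `*` (ball (ratr i.1.2 : R) i.2.+1%:R^-1).
have -> : G = \bigcup_(i in [set i | B i `<=` G]) B i.
  apply/seteqP; split=> [z Gz|z [i /= + Biz]]; last exact.
  have [e /= e0 zeG] : exists2 e : R, 0 < e & ball (z : R * R) e `<=` G.
    by move/nbhs_ballP : (oG z Gz).
  have e20 : 0 < e / 2 by rewrite divr_gt0.
  have [n ne] : exists n : nat, n.+1%:R^-1 < e / 2.
    have [n _ /(_ _ (leqnn n))] := near_infty_natSinv_lt (PosNum e20).
    by exists n.
  have n0 : (0 : R) < n.+1%:R^-1 by rewrite invr_gt0.
  have approx (x : R) : exists q : rat, ball (ratr q : R) n.+1%:R^-1 x.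
    have [|y [/= xy [q _ qy]]] := @dense_rat R (ball x n.+1%:R^-1) _ (ball_open x _).
      by exists x; exact: ballxx.
    by exists q; rewrite qy; exact: ball_sym.
  have [q1 Hq1] := approx z.1.
  have [q2 Hq2] := approx z.2.
  exists (q1, q2, n) => //= w [/= w1 w2]; apply: zeG.
  have zw (q : rat) (x y : R) : ball (ratr q : R) n.+1%:R^-1 x ->
      ball (ratr q : R) n.+1%:R^-1 y -> ball x e y.
    move=> qx qy; rewrite (splitr e).
    apply: (@ball_triangle R R (ratr q) x y (e / 2) (e / 2)).
      by apply: ball_sym; apply: le_ball qx; exact: ltW.
    by apply: le_ball qy; exact: ltW.
  by split; [exact: (zw q1)|exact: (zw q2)].
rewrite bigcup_mkcond; apply: countable_bigcupT_measurable => // i.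
case: ifPn => // _.
apply: measurableX; apply: open_measurable; exact: ball_open.
Qed.

Lemma jordan_parametrization_measurable L (gamma : R -> plane R) Gamma :
  jordan_parametrization L gamma Gamma ->
  measurable_fun [set: measurableTypeR R] (gamma : measurableTypeR R -> plane R).
Proof.
move=> [_ cg _ _ _].
apply/measurable_fun_pairP; split; apply: continuous_measurable_fun => t.
  apply: (@continuous_comp R (R * R)%type R gamma fst); [exact: cg|exact: cvg_fst].
apply: (@continuous_comp R (R * R)%type R gamma snd); [exact: cg|exact: cvg_snd].
Qed.

Lemma bounded_domain_measurable (G Gamma : set (plane R)) :
  bounded_domain_with_boundary G Gamma -> measurable G.
Proof. by case=> oG _ _ _ _; exact: open_measurable_plane. Qed.

End measurability.

(* The arclength measure on Gamma is the image under gamma of Lebesgue measure on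
   one period. *)
Section arclength_measure.
Context {R : realType} {L : R} {gamma : R -> plane R} {Gamma : set (plane R)}.

Definition arclength_measure (_ : arclength_parametrization L gamma Gamma) :
    set (plane R) -> \bar R :=
  pushforward (mrestr (@lebesgue_measure R) (measurable_itv `[0, L[))
    (gamma : measurableTypeR R -> plane R).

Variable hgamma : arclength_parametrization L gamma Gamma.

HB.instance Definition _ := Measure.copy (arclength_measure hgamma)
  (measure_function_pushforward__canonical__measure_function_Measure
    (mrestr (@lebesgue_measure R) (measurable_itv `[0, L[))
    (jordan_parametrization_measurable (proj1 hgamma))).

End arclength_measure.

Definition area_measure (R : realType) (G Gamma : set (plane R))
    (hG : bounded_domain_with_boundary G Gamma) :
    {measure set (plane R) -> \bar R} :=
  mrestr (@lebesgue_measure R \x @lebesgue_measure R)%E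
    (bounded_domain_measurable hG).

Section orthonormal_polynomials.
Context {R : realType}.
Implicit Types (mu : {measure set (plane R) -> \bar R}) (p : nat -> {poly R[i]}).

Definition msupport mu : set (plane R) :=
  [set z | forall U, open U -> U z -> (0 < mu U)%E].

Definition compact_infinite_support_measure mu :=
  [/\ (mu setT < +oo)%E, compact (msupport mu) & infinite_set (msupport mu)].

Definition cintegral mu (h : plane R -> R[i]) : R[i] :=
  Complex (Rintegral mu setT (fun z => complex.Re (h z)))
          (Rintegral mu setT (fun z => complex.Im (h z))).

Definition inner mu (f g : plane R -> R[i]) : R[i] :=
  cintegral mu (fun z => f z * conjc (g z)).

Definition peval (q : {poly R[i]}) (z : plane R) : R[i] := q.[toC z].

Definition orthonormal_polynomials mu p :=
  (forall n, size (p n) = n.+1 /\ 0 < lead_coef (p n)) /\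
  (forall m n, inner mu (peval (p m)) (peval (p n)) = (m == n)%:R).

Definition L2norm mu (f : plane R -> R[i]) : \bar R :=
  Lnorm mu 2%:E (fun z => (Normc.normc (f z))%:E).

(* mu0 = mu1 + mu2 is a polynomially small perturbation of mu1. The orthonormal
   polynomials of a measure with infinite compact support exist and are unique;
   existence is asserted so that the limit condition is never vacuous. *)
Definition PS_perturbation mu0 mu1 mu2 :=
  [/\ compact_infinite_support_measure mu0 /\
        compact_infinite_support_measure mu1,
      forall A, measurable A -> mu0 A = (mu1 A + mu2 A)%E,
      exists2 A, measurable A & mu2 A != 0%E,
      exists p, orthonormal_polynomials mu1 p &
      forall p, orthonormal_polynomials mu1 p ->
        L2norm mu2 (peval (p n)) @[n --> \oo] --> 0%E].

End orthonormal_polynomials.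

(* Main.v *)
(** For [z] in [G] and a polynomial [p], Cauchy's formula for [p ^+ 2] gives
    [|p z|^2 <= C * \int_Gamma |p w|^2 / |w - z| ds(w)], provided the winding number
    of [Gamma] about [z] is not [0].  It is constant on [G], and nonzero at a point of [G]
    close to the rightmost point of [Gamma]: the horizontal ray from that point to
    the right crosses [Gamma] exactly once, and transversally.  For orthonormal [p n]
    the estimate first bounds the evaluation functionals, so [p n z --> 0] by Bessel's
    inequality.  Cutting the kernel [1 / |w - z|] at height [2^J], it also bounds
    [|p n|^2] by [C * 2^J] plus a function whose area integral is [O(2^-J)]
    uniformly in [n]; dominated convergence applies to the bounded part. *)

Require Import Defs.
From mathcomp Require Import all_boot all_order all_algebra.
From mathcomp Require Import all_classical all_reals all_analysis.
From mathcomp Require Import measurable_realfun complex ring lra.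
Import Order.TTheory GRing.Theory Num.Theory.
Import numFieldNormedType.Exports.
Local Open Scope classical_set_scope.
Local Open Scope ring_scope.

Set Implicit Arguments.
Unset Strict Implicit.
Unset Printing Implicit Defensive.

(** * Real calculus *)

(** Squaring [p] makes the right-hand side linear in the density [|p w|^2], whose integral over
    [Gamma] is [1] for an orthonormal polynomial; Tonelli's theorem can then integrate the kernel in
    [z] first. The obstacle is that [1 / |w - z|] has no bound uniform in [z] up to [Gamma]. Its
    area integral near [w] is nevertheless small uniformly in [w]: a square of side [2 * 2^-k] has
    area [4 * 4^-k], while the kernel grows only like [2^k]. Concentric squares suit the product
    measure and the sup norm of the plane. A ray from an arbitrary point of [G] may cross the curve
    many times, or touch it, with cancelling contributions to the winding number. Near a rightmost
    point this cannot happen: whatever the ray meets lies in a small region between its origin and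
    the largest abscissa, and there the curve is a single nearly vertical arc, because an arclength
    parametrization has nonzero derivative. *)

Section calculus.
Context {R : realType}.
Implicit Types (f g : R -> R) (a b t L : R).

Lemma is_derive_div f g t (df dg : R) : g t != 0 ->
  is_derive t 1 f df -> is_derive t 1 g dg ->
  is_derive t 1 (fun s => f s / g s) ((df * g t - f t * dg) / g t ^+ 2).
Proof.
move=> gt0 hf hg.
have hgV := is_deriveV gt0 hg.
have h : is_derive t 1 (fun s => f s / g s) _ := is_deriveM hf hgV.
apply: (is_derive_eq h).
rewrite /GRing.scale /=; field.
exact: gt0.
Qed.

Lemma derive_mono_const f a : (forall t, a < t -> is_derive t 1 f 0) ->
  forall s t, a < s -> a < t -> f s = f t.
Proof.
move=> df s t.
wlog st : s t / s <= t.
  move=> h as_ at_; case: (leP s t) => [|/ltW] st; first exact: h.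
  by apply/esym/h.
move=> as_ at_.
have [||c _ ] := @MVT_segment R f (fun=> 0) s t st.
- by move=> x /itvP xst; apply: df; apply: (lt_le_trans as_); rewrite xst.
- apply: continuous_in_subspaceT => x /set_mem /= /itvP xst.
  have hx := df x (lt_le_trans as_ _).
  apply/differentiable_continuous/derivable1_diffP.
  by apply: ex_derive; apply: hx; rewrite xst.
by rewrite mul0r => /subr0_eq.
Qed.

(** An integral with lower limit [a] is a primitive only to the right of [a]. Callers take [a]
    strictly below the interval of interest, so that its endpoints become interior points with
    two-sided derivatives. *)
Lemma primitive_exists f a : continuous f ->
  exists F : R -> R, forall t, a < t -> is_derive t 1 F (f t).
Proof.
move=> cf; exists (fun x => \int[lebesgue_measure]_(t in `[a, x]) f t).
move=> t at_.
have tt1 : t < t + 1 by rewrite ltrDl.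
have [|||h1 h2] := @continuous_FTC1 R f (BLeft a) t (t + 1) tt1.
- apply: continuous_compact_integrable; first exact: segment_compact.
  by apply: continuous_subspaceT => x; exact: cf.
- by rewrite /= ltEereal /= .
- exact: cf.
apply: DeriveDef => //.
by rewrite -derive1E h2.
Qed.

Lemma is_derive_continuous f t (df : R) : is_derive t 1 f df -> {for t, continuous f}.
Proof.
move=> hf; apply/differentiable_continuous/derivable1_diffP.
by apply: ex_derive; apply: hf.
Qed.

Lemma Rintegral_primitive f F a b : a <= b -> continuous f ->
  (forall t, a <= t <= b -> is_derive t 1 F (f t)) ->
  \int[lebesgue_measure]_(t in `[a, b]) f t = F b - F a.
Proof.
rewrite le_eqVlt => /predU1P[-> _ _|ab cf dF].
  by rewrite set_itv1 Rintegral_set1 subrr.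
rewrite /Rintegral (continuous_FTC2 (F := F) ab) //.
- by apply: continuous_subspaceT => x; exact: cf.
- split.
  + by move=> x /itvP xab; apply: ex_derive; apply: dF; rewrite !xab.
  + apply: cvg_at_right_filter; apply: (@is_derive_continuous F a (f a)).
    by apply: dF; rewrite lexx ltW.
  + apply: cvg_at_left_filter; apply: (@is_derive_continuous F b (f b)).
    by apply: dF; rewrite lexx ltW.
- move=> x /itvP xab; rewrite derive1E; apply: derive_val; apply: dF.
  by rewrite !xab.
Qed.

(** The increment [F (t + L) - F t] of a primitive has derivative [f (t + L) - f t = 0], hence is
    constant. The base point [m] lies below both [a] and [0], so that both increments can be
    compared. *)
Lemma Rintegral_periodic f L a : 0 < L -> continuous f ->
  (forall t, f (t + L) = f t) ->
  \int[lebesgue_measure]_(t in `[a, a + L]) f t =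
  \int[lebesgue_measure]_(t in `[0, L]) f t.
Proof.
move=> L0 cf pf.
pose m := Num.min a 0 - 1.
have ma : m < a by rewrite /m ltrBlDr (@le_lt_trans _ _ a) ?ltrDl // ge_min lexx.
have m0 : m < 0 by rewrite /m ltrBlDr (@le_lt_trans _ _ 0) // ge_min lexx orbT.
have [F dF] := primitive_exists m cf.
have tr x : m < x -> forall t, x <= t <= x + L -> is_derive t 1 F (f t).
  by move=> mx t /andP[xt _]; apply: dF; exact: lt_le_trans xt.
rewrite (Rintegral_primitive _ cf (tr a ma)) ?lerDl ?(ltW L0) //.
have tr0 := tr 0 m0; rewrite add0r in tr0.
rewrite (Rintegral_primitive (ltW L0) cf tr0).
have := @derive_mono_const (fun t => F (t + L) - F t) m _ a 0 ma m0.
rewrite add0r; apply => t mt.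
have h1 : is_derive (t + L) 1 F (f t).
  by rewrite -pf; apply: dF; rewrite (lt_trans mt) // ltrDl.
have h2 : is_derive t 1 (fun t : R => t + L) 1.
  by apply: is_derive_eq; rewrite addr0.
have h : is_derive t 1 (fun t => F (t + L) - F t) _ :=
  is_deriveB (@is_derive1_comp R F (fun s => s + L) t _ _ h1 h2) (dF t mt).
by apply: (is_derive_eq h); rewrite mulr1 subrr.
Qed.

Section continuity.
Variables (T : topologicalType) (f g : T -> R).
Hypotheses (cf : continuous f) (cg : continuous g).

Lemma continuous_add : continuous (fun x => f x + g x).
Proof. by move=> x; exact: (@continuousD R R^o T f g x (@cf x) (@cg x)). Qed.

Lemma continuous_sub : continuous (fun x => f x - g x).
Proof. by move=> x; exact: (@continuousB R R^o T f g x (@cf x) (@cg x)). Qed.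

Lemma continuous_mul : continuous (fun x => f x * g x).
Proof. by move=> x; exact: (@continuousM R T f g x (@cf x) (@cg x)). Qed.

Lemma continuous_opp : continuous (fun x => - f x).
Proof. by move=> x; exact: (@continuousN R R^o T f x (@cf x)). Qed.

Lemma continuous_sqr : continuous (fun x => f x ^+ 2).
Proof. by move=> x; exact: (@continuousM R T f f x (@cf x) (@cf x)). Qed.

Lemma continuous_invr : (forall x, f x != 0) -> continuous (fun x => (f x)^-1).
Proof. by move=> f0 x; apply: continuousV; [exact: f0|exact: cf]. Qed.

Lemma continuous_sqrtr : continuous (fun x => Num.sqrt (f x)).
Proof.
by move=> x; apply: (continuous_comp (@cf x)); exact: sqrt_continuous.
Qed.

End continuity.

End calculus.

(** * Complex-valued functions of a real variable *)

Section complex_calculus.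
Context {R : realType}.
Local Notation C := (R[i]).
Local Notation Re := complex.Re.
Local Notation Im := complex.Im.
Implicit Types (f g : R -> C) (t L : R) (z w : C).

Lemma ReD z w : Re (z + w) = Re z + Re w. Proof. by case: z; case: w. Qed.
Lemma ImD z w : Im (z + w) = Im z + Im w. Proof. by case: z; case: w. Qed.
Lemma ReB z w : Re (z - w) = Re z - Re w. Proof. by case: z; case: w. Qed.
Lemma ImB z w : Im (z - w) = Im z - Im w. Proof. by case: z; case: w. Qed.
Lemma ReM z w : Re (z * w) = Re z * Re w - Im z * Im w.
Proof. by case: z; case: w. Qed.
Lemma ImM z w : Im (z * w) = Re z * Im w + Im z * Re w.
Proof. by case: z => a b; case: w => x y /=; rewrite addrC mulrC. Qed.
Lemma ReV z : Re z^-1 = Re z / (Re z ^+ 2 + Im z ^+ 2).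
Proof. by case: z. Qed.
Lemma ImV z : Im z^-1 = - Im z / (Re z ^+ 2 + Im z ^+ 2).
Proof. by case: z => a b /=; rewrite mulNr. Qed.

Lemma sqr_ReIm_neq0 z : z != 0 -> Re z ^+ 2 + Im z ^+ 2 != 0.
Proof.
case: z => a b; rewrite eq_complex /= negb_and => /orP[] h; apply: lt0r_neq0.
  by rewrite ltr_pwDl ?sqr_ge0 // lt_neqAle sqr_ge0 andbT eq_sym expf_eq0 /=.
by rewrite ltr_wpDl ?sqr_ge0 // lt_neqAle sqr_ge0 andbT eq_sym expf_eq0 /=.
Qed.

Lemma normc_ge0 z : 0 <= Normc.normc z.
Proof. by case: z => a b /=; exact: sqrtr_ge0. Qed.

Lemma normcE z : Normc.normc z = Num.sqrt (Re z ^+ 2 + Im z ^+ 2).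
Proof. by case: z. Qed.

Lemma normc_sqr z : Normc.normc z ^+ 2 = Re z ^+ 2 + Im z ^+ 2.
Proof. by rewrite normcE sqr_sqrtr // addr_ge0 ?sqr_ge0. Qed.

Lemma normc_le z : Normc.normc z <= `|Re z| + `|Im z|.
Proof.
rewrite -(@ler_pXn2r _ 2) ?nnegrE ?addr_ge0 ?normc_ge0 //.
rewrite normc_sqr sqrrD !real_normK ?num_real // addrAC lerDl.
by rewrite mulrn_wge0 // mulr_ge0.
Qed.

Lemma Re_le_normc z : `|Re z| <= Normc.normc z.
Proof.
rewrite -(@ler_pXn2r _ 2) ?nnegrE ?normc_ge0 //.
by rewrite normc_sqr real_normK ?num_real // lerDl sqr_ge0.
Qed.

Lemma Im_le_normc z : `|Im z| <= Normc.normc z.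
Proof.
rewrite -(@ler_pXn2r _ 2) ?nnegrE ?normc_ge0 //.
by rewrite normc_sqr real_normK ?num_real // lerDr sqr_ge0.
Qed.

(** Stated coordinatewise, so that the real lemmas on derivatives and primitives apply to [Re] and
    [Im] separately. *)
Definition is_cderive t f (d : C) :=
  is_derive t 1 (fun s => Re (f s)) (Re d) /\
  is_derive t 1 (fun s => Im (f s)) (Im d).

Definition ccontinuous f :=
  continuous (fun s => Re (f s)) /\ continuous (fun s => Im (f s)).

Lemma is_cderive_cst t z : is_cderive t (fun=> z) 0.
Proof. by split; exact: is_derive_cst. Qed.

Lemma is_cderiveD t f g df dg : is_cderive t f df -> is_cderive t g dg ->
  is_cderive t (fun s => f s + g s) (df + dg).
Proof.
move=> [f1 f2] [g1 g2]; split.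
  under [X in is_derive _ _ X _]eq_fun do rewrite ReD.
  by rewrite ReD; exact: is_deriveD.
under [X in is_derive _ _ X _]eq_fun do rewrite ImD.
by rewrite ImD; exact: is_deriveD.
Qed.

Lemma is_cderiveM t f g df dg : is_cderive t f df -> is_cderive t g dg ->
  is_cderive t (fun s => f s * g s) (df * g t + f t * dg).
Proof.
move=> [f1 f2] [g1 g2]; split.
  under [X in is_derive _ _ X _]eq_fun do rewrite ReM.
  have h := is_deriveB (is_deriveM f1 g1) (is_deriveM f2 g2).
  apply: (is_derive_eq h); rewrite ReD !ReM /GRing.scale /=; ring.
under [X in is_derive _ _ X _]eq_fun do rewrite ImM.
have h := is_deriveD (is_deriveM f1 g2) (is_deriveM f2 g1).
apply: (is_derive_eq h); rewrite ImD !ImM /GRing.scale /=; ring.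
Qed.

Lemma is_cderive_poly t f df (p : {poly C}) : is_cderive t f df ->
  is_cderive t (fun s => p.[f s]) (p^`().[f t] * df).
Proof.
move=> hf; elim/poly_ind: p => [|p a IH].
  under [X in is_cderive _ X]eq_fun do rewrite horner0.
  by rewrite deriv0 horner0 mul0r; exact: is_cderive_cst.
under [X in is_cderive _ X]eq_fun do rewrite hornerMXaddC.
rewrite derivMXaddC hornerD hornerMX mulrDl.
have -> : p.[f t] * df + p^`().[f t] * f t * df =
  p^`().[f t] * df * f t + p.[f t] * df + 0 by ring.
apply: is_cderiveD (is_cderive_cst _ _).
exact: is_cderiveM.
Qed.

Lemma is_cderive_continuous f (df : R -> C) :
  (forall t, is_cderive t f (df t)) -> ccontinuous f.
Proof.
move=> h; split=> t; have [h1 h2] := h t.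
  exact: is_derive_continuous h1.
exact: is_derive_continuous h2.
Qed.

Lemma ccontinuous_cst z : ccontinuous (fun=> z).
Proof. by split=> t; exact: cvg_cst. Qed.

Lemma ccontinuousD f g : ccontinuous f -> ccontinuous g ->
  ccontinuous (fun s => f s + g s).
Proof.
move=> [f1 f2] [g1 g2]; split.
  under [X in continuous X]eq_fun do rewrite ReD.
  exact: continuous_add.
under [X in continuous X]eq_fun do rewrite ImD.
exact: continuous_add.
Qed.

Lemma ccontinuousM f g : ccontinuous f -> ccontinuous g ->
  ccontinuous (fun s => f s * g s).
Proof.
move=> [f1 f2] [g1 g2]; split.
  under [X in continuous X]eq_fun do rewrite ReM.
  by apply: continuous_sub; exact: continuous_mul.
under [X in continuous X]eq_fun do rewrite ImM.
by apply: continuous_add; exact: continuous_mul.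
Qed.

Lemma continuous_sqr_ReIm f : ccontinuous f ->
  continuous (fun s => Re (f s) ^+ 2 + Im (f s) ^+ 2).
Proof. by move=> [f1 f2]; apply: continuous_add; exact: continuous_sqr. Qed.

Lemma ccontinuousV f : (forall s, f s != 0) -> ccontinuous f ->
  ccontinuous (fun s => (f s)^-1).
Proof.
move=> f0 cf; have [f1 f2] := cf.
have cn : continuous (fun s => (Re (f s) ^+ 2 + Im (f s) ^+ 2)^-1).
  apply: continuous_invr (continuous_sqr_ReIm cf) _ => x.
  exact: sqr_ReIm_neq0.
split.
  under [X in continuous X]eq_fun do rewrite ReV.
  exact: continuous_mul.
under [X in continuous X]eq_fun do rewrite ImV.
by apply: continuous_mul cn; exact: continuous_opp.
Qed.

Lemma ccontinuous_poly (p : {poly C}) f : ccontinuous f ->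
  ccontinuous (fun s => p.[f s]).
Proof.
move=> cf; elim/poly_ind: p => [|p a IH].
  by under [X in ccontinuous X]eq_fun do rewrite horner0; exact: ccontinuous_cst.
under [X in ccontinuous X]eq_fun do rewrite hornerMXaddC.
exact: ccontinuousD (ccontinuousM IH cf) (ccontinuous_cst a).
Qed.

Lemma continuous_normc f : ccontinuous f -> continuous (fun s => Normc.normc (f s)).
Proof.
move=> cf; under [X in continuous X]eq_fun do rewrite normcE.
exact/continuous_sqrtr/continuous_sqr_ReIm.
Qed.

Lemma antiderivative_exists (p : {poly C}) : exists q, q^`() = p.
Proof.
exists (\poly_(i < (size p).+1) (p`_i.-1 / i%:R)).
apply/polyP => i; rewrite coef_deriv coef_poly.
case: ltnP => [ip|]; last first.
  by rewrite ltnS => ip; rewrite mul0rn nth_default.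
by rewrite /= -[LHS]mulr_natr divfK // pnatr_eq0.
Qed.

Lemma divided_difference (p : {poly C}) z :
  exists q : {poly C}, forall w, p.[w] = p.[z] + q.[w] * (w - z).
Proof.
have : root (p - p.[z]%:P) z by rewrite rootE !hornerE subrr.
move=> /factor_theorem[q pq]; exists q => w.
have -> : p = p.[z]%:P + q * ('X - z%:P) by rewrite -pq addrC subrK.
by rewrite !hornerE subrr mulr0 addr0.
Qed.

End complex_calculus.

(** * Winding number and Cauchy's estimate *)

Section winding.
Context {R : realType}.
Local Notation C := (R[i]).
Local Notation Re := complex.Re.
Local Notation Im := complex.Im.

Lemma continuous_integrable (f : R -> R) (a b : R) : continuous f ->
  lebesgue_measure.-integrable `[a, b] (EFin \o f).
Proof.
move=> cf; apply: continuous_compact_integrable; first exact: segment_compact.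
by apply: continuous_subspaceT => x; exact: cf.
Qed.

Definition closed_C1_curve (L : R) (c dc : R -> C) :=
  [/\ 0 < L, forall t, is_cderive t c (dc t), ccontinuous dc &
      forall t, c (t + L) = c t].

(* [2 * pi] times the winding number of [c] around [z]. *)
Definition winding (L : R) (c dc : R -> C) (z : C) : R :=
  \int[lebesgue_measure]_(t in `[0, L]) Im (dc t / (c t - z)).

Variables (L : R) (c dc : R -> C).
Hypothesis hc : closed_C1_curve L c dc.

Lemma curve_continuous : ccontinuous c.
Proof. by case: hc => _ h _ _; exact: is_cderive_continuous h. Qed.

Lemma is_cderive_curveB (z : C) (t : R) : is_cderive t (fun s => c s - z) (dc t).
Proof.
case: hc => _ h _ _; rewrite -[dc t]addr0.
by apply: is_cderiveD => //; exact: is_cderive_cst.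
Qed.

Lemma curve_derive_periodic (t : R) : dc (t + L) = dc t.
Proof.
case: hc => L0 h _ p; have [h1 h2] := h (t + L); have [k1 k2] := h t.
have hs : is_derive t 1 (fun t : R => t + L) 1.
  by apply: is_derive_eq; rewrite addr0.
have m1 := @is_derive1_comp R (fun s => Re (c s)) (fun t : R => t + L) t _ _ h1 hs.
have m2 := @is_derive1_comp R (fun s => Im (c s)) (fun t : R => t + L) t _ _ h2 hs.
have e1 : (fun s => Re (c s)) \o (fun t : R => t + L) = (fun s => Re (c s)).
  by apply/funext => s /=; rewrite p.
have e2 : (fun s => Im (c s)) \o (fun t : R => t + L) = (fun s => Im (c s)).
  by apply/funext => s /=; rewrite p.
rewrite e1 mulr1 in m1; rewrite e2 mulr1 in m2.
apply/eqP; rewrite eq_complex; apply/andP; split; apply/eqP.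
  by rewrite -(@derive_val _ _ _ _ _ _ _ m1) (@derive_val _ _ _ _ _ _ _ k1).
by rewrite -(@derive_val _ _ _ _ _ _ _ m2) (@derive_val _ _ _ _ _ _ _ k2).
Qed.

Lemma ccontinuous_kernel (z : C) : (forall t, c t != z) ->
  ccontinuous (fun t => dc t / (c t - z)).
Proof.
move=> cz; case: hc => _ _ cdc _; apply: ccontinuousM => //.
apply: ccontinuousV => [s|]; first by rewrite subr_eq0.
exact: ccontinuousD curve_continuous (ccontinuous_cst _).
Qed.

(* Since [(q(w) - q(z)) / (w - z)] is a polynomial in [w], it integrates to [0]
   along the closed curve. *)
Lemma cauchy_estimate (q : {poly C}) (z : C) : (forall t, c t != z) ->
  Normc.normc q.[z] * `|winding L c dc z| <=
  2 * \int[lebesgue_measure]_(t in `[0, L])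
        Normc.normc (q.[c t] * (dc t / (c t - z))).
Proof.
move=> cz; have [L0 hd _ p] := hc.
pose k t := dc t / (c t - z).
have ck : ccontinuous k by exact: ccontinuous_kernel.
have [K1 dK1] := primitive_exists (-1) ck.1.
have [K2 dK2] := primitive_exists (-1) ck.2.
(* A primitive of the kernel along the curve, that is, a branch of the logarithm of [c t - z] up to
   a constant; the imaginary part of its increment over a period is the winding integral. *)
pose K t := Complex (K1 t) (K2 t).
have dK t : 0 <= t <= L -> is_cderive t K (k t).
  move=> /andP[t0 _]; have t1 : -1 < t by exact: lt_le_trans t0.
  by split; [exact: dK1|exact: dK2].
have [Q qQ] := divided_difference q z.
have [P PQ] := antiderivative_exists Q.
(* With [q(w) = q(z) + Q(w) (w - z)] and [P' = Q], this is a primitive of [q(c) dc / (c - z)]. Over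
   a period the [P] part cancels, the curve being closed. *)
pose F t := q.[z] * K t + P.[c t].
pose f t := q.[c t] * k t.
have dF t : 0 <= t <= L -> is_cderive t F (f t).
  move=> t0L; have -> : f t = 0 * K t + q.[z] * k t + P^`().[c t] * dc t.
    rewrite PQ /f qQ mul0r add0r mulrDl -mulrA /k; congr (_ + _ * _).
    by rewrite mulrC divfK // subr_eq0.
  apply: is_cderiveD; last exact: is_cderive_poly.
  by apply: is_cderiveM (dK t t0L); exact: is_cderive_cst.
have cf : ccontinuous f.
  apply: ccontinuousM ck; exact: ccontinuous_poly curve_continuous.
have eF : F L - F 0 = q.[z] * (K L - K 0).
  by rewrite /F -[in P.[c L]](add0r L) p; ring.
have iR : \int[lebesgue_measure]_(t in `[0, L]) Re (f t) = Re (F L - F 0).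
  rewrite ReB; apply: (@Rintegral_primitive _ _ (fun t => Re (F t)) _ _ (ltW L0) cf.1).
  by move=> t /dF[].
have iI : \int[lebesgue_measure]_(t in `[0, L]) Im (f t) = Im (F L - F 0).
  rewrite ImB; apply: (@Rintegral_primitive _ _ (fun t => Im (F t)) _ _ (ltW L0) cf.2).
  by move=> t /dF[].
have iW : winding L c dc z = Im (K L - K 0).
  rewrite ImB; apply: (@Rintegral_primitive _ _ (fun t => Im (K t)) _ _ (ltW L0) ck.2).
  by move=> t /dK[].
have cn := continuous_normc cf.
apply: (@le_trans _ _ (Normc.normc (F L - F 0))).
  by rewrite eF Normc.normcM iW ler_wpM2l ?normc_ge0 // Im_le_normc.
(* Origin of the factor [2]: the norm is at most [|Re| + |Im|], and each part is bounded by the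
   integral of the norm. *)
apply: le_trans (normc_le _) _.
rewrite -iR -iI mulr_natl mulr2n.
apply: lerD.
  apply: le_trans (le_normr_Rintegral _ _) _ => //.
    exact: continuous_integrable cf.1.
  apply: le_Rintegral => //; [|exact: continuous_integrable|].
    apply: continuous_integrable => t; apply: (continuous_comp (cf.1 t)).
    exact: norm_continuous.
  by move=> t _; exact: Re_le_normc.
apply: le_trans (le_normr_Rintegral _ _) _ => //.
  exact: continuous_integrable cf.2.
apply: le_Rintegral => //; [|exact: continuous_integrable|].
  apply: continuous_integrable => t; apply: (continuous_comp (cf.2 t)).
  exact: norm_continuous.
by move=> t _; exact: Im_le_normc.
Qed.

Lemma normc_neq (z w : C) : (0 < Normc.normc (z - w)) -> z != w.
Proof. by apply: contraTN => /eqP ->; rewrite subrr Normc.normc0 ltxx. Qed.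

(* The quotient [(c - w) / (c - z)] has positive real part, so its argument is
   a single-valued [atan] along the closed curve. *)
Lemma winding_locally_constant (z w : C) :
  (forall t, Normc.normc (w - z) < Normc.normc (c t - z)) ->
  winding L c dc w = winding L c dc z.
Proof.
move=> wz; have [L0 hd cdc p] := hc.
have cz t : c t != z.
  by apply: normc_neq; exact: le_lt_trans (normc_ge0 _) (wz t).
have cw t : c t != w.
  by apply/eqP => ctw; have := wz t; rewrite ctw ltxx.
pose a1 t := Re (c t - z); pose a2 t := Im (c t - z).
pose b1 t := Re (c t - w); pose b2 t := Im (c t - w).
(* [N + i M] is [c - w] times the conjugate of [c - z], a positive multiple of the quotient.
   Positivity of [N] is polarization: [2 N = |c - z|^2 + |c - w|^2 - |w - z|^2]. *)
pose N t := b1 t * a1 t + b2 t * a2 t.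
pose M t := b2 t * a1 t - b1 t * a2 t.
have N0 t : 0 < N t.
  have : Normc.normc (w - z) ^+ 2 < Normc.normc (c t - z) ^+ 2.
    by rewrite ltr_pXn2r ?nnegrE ?normc_ge0.
  rewrite !normc_sqr /N /a1 /b1 /a2 /b2 !ReB !ImB.
  set x := Re (c t); set y := Im (c t); set x0 := Re z; set y0 := Im z.
  set x1 := Re w; set y1 := Im w => h.
  have h1 : 0 <= (x - x1) ^+ 2 by exact: sqr_ge0.
  have h2 : 0 <= (y - y1) ^+ 2 by exact: sqr_ge0.
  lra.
have da t := is_cderive_curveB z t.
have db t := is_cderive_curveB w t.
have dM (t : R) : is_derive t 1 M (Im (dc t) * a1 t + b2 t * Re (dc t)
    - (Re (dc t) * a2 t + b1 t * Im (dc t))).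
  have [x1 x2] := da t; have [y1 y2] := db t.
  apply: (is_derive_eq (is_deriveB (is_deriveM y2 x1) (is_deriveM y1 x2))).
  by rewrite /GRing.scale /= -/(a1 t) -/(a2 t) -/(b1 t) -/(b2 t); ring.
have dN (t : R) : is_derive t 1 N (Re (dc t) * a1 t + b1 t * Re (dc t)
    + (Im (dc t) * a2 t + b2 t * Im (dc t))).
  have [x1 x2] := da t; have [y1 y2] := db t.
  apply: (is_derive_eq (is_deriveD (is_deriveM y1 x1) (is_deriveM y2 x2))).
  by rewrite /GRing.scale /= -/(a1 t) -/(a2 t) -/(b1 t) -/(b2 t); ring.
pose A t := atan (M t / N t).
pose f t := Im (dc t / (c t - w)) - Im (dc t / (c t - z)).
have dA (t : R) : is_derive t 1 A (f t).
  have hq := is_derive_div (lt0r_neq0 (N0 t)) (dM t) (dN t).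
  have h := @is_derive1_comp R atan (fun s => M s / N s) t _ _ (is_derive1_atan _) hq.
  apply: (is_derive_eq h).
  have a0 : a1 t ^+ 2 + a2 t ^+ 2 != 0.
    by apply: sqr_ReIm_neq0; rewrite subr_eq0.
  have b0 : b1 t ^+ 2 + b2 t ^+ 2 != 0.
    by apply: sqr_ReIm_neq0; rewrite subr_eq0.
  have nm : N t ^+ 2 + M t ^+ 2 =
      (a1 t ^+ 2 + a2 t ^+ 2) * (b1 t ^+ 2 + b2 t ^+ 2) by rewrite /N /M; ring.
  have n0 : N t != 0 by exact: lt0r_neq0.
  have nm0 : N t ^+ 2 + M t ^+ 2 != 0 by rewrite nm mulf_neq0.
  rewrite /f !ImM !ReV !ImV -/(a1 t) -/(a2 t) -/(b1 t) -/(b2 t).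
  transitivity (((Im (dc t) * a1 t + b2 t * Re (dc t)
    - (Re (dc t) * a2 t + b1 t * Im (dc t))) * N t - M t * (Re (dc t) * a1 t + b1 t * Re (dc t)
    + (Im (dc t) * a2 t + b2 t * Im (dc t)))) / (N t ^+ 2 + M t ^+ 2)).
    by field; rewrite n0 nm0.
  rewrite nm /N /M; move: (a1 t) (a2 t) (b1 t) (b2 t) a0 b0 => x1 x2 y1 y2 h1 h2.
  by field; rewrite h1 h2.
have pA : A L = A 0.
  by rewrite /A /M /N /a1 /a2 /b1 /b2 -(add0r L) p.
have cf (v : C) : (forall t, c t != v) -> continuous (fun t => Im (dc t / (c t - v))).
  by move=> cv; exact: (ccontinuous_kernel cv).2.
have : \int[lebesgue_measure]_(t in `[0, L]) f t = 0.
  have cff : continuous f by exact: continuous_sub (cf _ cw) (cf _ cz).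
  by rewrite (Rintegral_primitive (ltW L0) cff (fun t _ => dA t)) pA subrr.
rewrite RintegralB //; [|exact: continuous_integrable (cf _ cw)|
  exact: continuous_integrable (cf _ cz)].
by move=> /subr0_eq.
Qed.

End winding.

(** * The argument along a curve that crosses a half-line once *)

Section simple_crossing.
Context {R : realType}.
Local Notation C := (R[i]).
Local Notation Re := complex.Re.
Local Notation Im := complex.Im.

Lemma continuous_dist_lt (f : R -> R) (a e : R) : {for a, continuous f} -> 0 < e ->
  exists2 d : R, 0 < d & forall s, `|s - a| < d -> `|f s - f a| < e.
Proof.
move=> cf e0; have /cvgrPdist_lt/(_ e e0) := cf.
move=> /nbhs_ballP[d /= d0 h]; exists d => // s sd.
by rewrite distrC; apply: h; rewrite /ball /= distrC.
Qed.

Lemma sqrt_gt_norm (u v : R) : v != 0 \/ u < 0 -> 0 < Num.sqrt (u ^+ 2 + v ^+ 2) - u.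
Proof.
move=> uv; rewrite subr_gt0.
have [u0|u0] := ltP u 0; first by rewrite (lt_le_trans u0) ?sqrtr_ge0.
case: uv => [v0|]; last by rewrite ltNge u0.
rewrite -{1}(ger0_norm u0) -sqrtr_sqr ltr_sqrt ?ltrDl.
  by rewrite lt_neqAle eq_sym sqrf_eq0 v0 sqr_ge0.
by rewrite ltr_wpDl ?sqr_ge0 // lt_neqAle eq_sym sqrf_eq0 v0 sqr_ge0.
Qed.

(* [arg_cut u v] is the argument of [- (u + i v)] in [(- pi, pi)]; it jumps
   across the half-line [v = 0], [u >= 0]. *)
Definition arg_cut (u v : R) : R := - (2 * atan (v / (Num.sqrt (u ^+ 2 + v ^+ 2) - u))).

(** The point [-(u + i v)] lies in the open third quadrant. In the formula,
    [sqrt (u^2 + v^2) < u + v] makes the quotient exceed [1], so its [atan] exceeds [pi / 4]. *)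
Lemma arg_cut_lt (u v : R) : 0 < u -> 0 < v -> arg_cut u v < - (pi / 2).
Proof.
move=> u0 v0; rewrite /arg_cut ltrN2.
have m0 : 0 < Num.sqrt (u ^+ 2 + v ^+ 2) - u.
  by apply: sqrt_gt_norm; left; exact: lt0r_neq0.
have -> : pi / 2 = 2 * (pi / 4) :> R by field.
rewrite ltr_pM2l // -atan1; apply: lt_atan.
rewrite ltr_pdivlMr // mul1r ltrBlDr.
rewrite -(@ltr_pXn2r _ 2) ?nnegrE ?sqrtr_ge0 ?addr_ge0 ?(ltW u0) ?(ltW v0) //.
rewrite sqr_sqrtr ?addr_ge0 ?sqr_ge0 //.
have := mulr_gt0 u0 v0; lra.
Qed.

Lemma arg_cutN (u v : R) : arg_cut u (- v) = - arg_cut u v.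
Proof. by rewrite /arg_cut sqrrN mulNr atanN mulrN opprK. Qed.

(** On opposite sides of the cut, one value lies above [pi / 2] and the other below [- pi / 2]. *)
Lemma arg_cut_gap (u v u' v' : R) : 0 < u -> 0 < u' -> v * v' < 0 ->
  pi < `|arg_cut u v - arg_cut u' v'|.
Proof.
move=> u0 u0' vv.
have e : - (pi / 2) - pi / 2 = - pi :> R by field.
have [v0|v0|v0] := ltgtP v 0; last by move: vv; rewrite v0 mul0r ltxx.
- have v0' : 0 < v' by move: vv; rewrite nmulr_rlt0.
  rewrite -[v]opprK arg_cutN.
  apply: lt_le_trans (ler_norm _).
  have h1 := arg_cut_lt u0' v0'; have h2 : arg_cut u (- v) < - (pi / 2).
    by apply: arg_cut_lt; rewrite ?oppr_gt0.
  lra.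
- have v0' : v' < 0 by move: vv; rewrite pmulr_rlt0.
  rewrite -normrN -[v']opprK arg_cutN.
  apply: lt_le_trans (ler_norm _).
  have h1 := arg_cut_lt u0 v0; have h2 : arg_cut u' (- v') < - (pi / 2).
    by apply: arg_cut_lt; rewrite ?oppr_gt0.
  lra.
Qed.

(** The derivative of any branch of the argument of [u + i v]; for [u + i v = c - z] it is the
    winding integrand [Im (dc / (c - z))]. The hypothesis on [u t] and [v t] says that the point is
    off the cut. *)
Lemma is_derive_arg_cut (u v : R -> R) (t du dv : R) :
  v t != 0 \/ u t < 0 -> is_derive t 1 u du -> is_derive t 1 v dv ->
  is_derive t 1 (fun s => arg_cut (u s) (v s))
    ((u t * dv - v t * du) / (u t ^+ 2 + v t ^+ 2)).
Proof.
move=> uv hu hv.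
have q0 : 0 < u t ^+ 2 + v t ^+ 2.
  case: uv => [v0|u0].
    by rewrite ltr_wpDl ?sqr_ge0 // lt_neqAle eq_sym sqrf_eq0 v0 sqr_ge0.
  by rewrite ltr_pwDl ?sqr_ge0 // lt_neqAle eq_sym sqrf_eq0 lt_eqF ?sqr_ge0.
pose r (s : R) : R := Num.sqrt (u s ^+ 2 + v s ^+ 2).
have r0 : 0 < r t by rewrite sqrtr_gt0.
have m0 : r t - u t != 0 by apply/lt0r_neq0/sqrt_gt_norm.
have hq : is_derive t 1 (fun s => u s ^+ 2 + v s ^+ 2) (2 * (u t * du + v t * dv)).
  apply: (is_derive_eq (is_deriveD (is_deriveM hu hu) (is_deriveM hv hv))).
  by rewrite /GRing.scale /=; ring.
have hr : is_derive t 1 r ((u t * du + v t * dv) / r t).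
  have h := @is_derive1_comp R Num.sqrt (fun s => u s ^+ 2 + v s ^+ 2) t _ _
    (is_derive1_sqrt q0) hq.
  by apply: (is_derive_eq h); rewrite -/(r t); field; exact: lt0r_neq0.
have hm : is_derive t 1 (fun s => r s - u s) ((u t * du + v t * dv) / r t - du).
  exact: is_deriveB.
have ha := @is_derive1_comp R atan (fun s => v s / (r s - u s)) t _ _
  (is_derive1_atan _) (@is_derive_div R v (fun s => r s - u s) t _ _ m0 hv hm).
have h2 : is_derive t 1 (fun s => arg_cut (u s) (v s)) _ :=
  is_deriveN (is_deriveZ 2 ha).
apply: (is_derive_eq h2).
have r2 : r t ^+ 2 = u t ^+ 2 + v t ^+ 2 by rewrite sqr_sqrtr // ltW.
rewrite /GRing.scale /= -r2.
have rn := lt0r_neq0 r0.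
(* In half-angle terms, [1 + (v / (r - u))^2 = 2 r / (r - u)]. With [v2], this clears the square
   root from the derivative of [atan]. *)
have e : (r t - u t) ^+ 2 + v t ^+ 2 = 2 * r t * (r t - u t).
  have -> : 2 * r t * (r t - u t) = 2 * r t ^+ 2 - 2 * r t * u t by ring.
  by rewrite sqrrB r2; ring.
have v2 : v t ^+ 2 = (r t - u t) * (r t + u t) by rewrite -subr_sqr r2; ring.
clear -e v2 rn m0.
move: (r t) (u t) (v t) e v2 rn m0 => x y z e z2 x0 xy0.
transitivity (- (2 * ((dv * (x - y) - z * ((y * du + z * dv) / x - du)) /
  ((x - y) ^+ 2 + z ^+ 2)))).
  by field; rewrite x0 xy0 !andbT e !mulf_neq0 ?pnatr_eq0.
rewrite e.
have -> : dv * (x - y) - z * ((y * du + z * dv) / x - du) =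
    (dv * (x - y) * x - z * y * du - z ^+ 2 * dv + z * du * x) / x by field.
rewrite z2; field.
by rewrite x0 xy0.
Qed.

Variables (L : R) (c dc : R -> C).
Hypothesis hc : closed_C1_curve L c dc.

(** Between two passages at [a], the cut argument [h] is a primitive of the winding integrand. So
    the primitive [F] varies over [[a + d, a + L - d]] by the jump of [h] across the half-line to
    the right of [z], which exceeds [pi]. Were the winding integral zero, continuity of [F] at both
    ends would force this variation below [2], and [2 <= pi]. *)
Lemma winding_simple_crossing (z : C) (a eta : R) :
  (forall t, c t != z) -> 0 < eta ->
  Im (c a) = Im z -> Re z < Re (c a) ->
  (forall t, a < t < a + L -> Im (c t) = Im z -> Re (c t) < Re z) ->
  (forall s, 0 < s < eta -> (Im (c (a + s)) - Im z) * (Im (c (a - s)) - Im z) < 0) ->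
  winding L c dc z != 0.
Proof.
move=> cz eta0 caz zca single crossing.
have [L0 hd cdc p] := hc.
have ck := ccontinuous_kernel hc cz.
pose f t := Im (dc t / (c t - z)).
pose u t := Re (c t - z); pose v t := Im (c t - z).
have cu : continuous u.
  exact: (ccontinuousD (curve_continuous hc) (ccontinuous_cst (- z))).1.
have [F dF] := primitive_exists (a - 1) ck.2.
have aa1 : a - 1 < a by rewrite ltrBlDr ltrDl.
have fp t : f (t + L) = f t by rewrite /f p (curve_derive_periodic hc).
have cf : continuous f by exact: ck.2.
have dFr s e : a - 1 < s -> forall t, s <= t <= e -> is_derive t 1 F (f t).
  by move=> as_ t /andP[st _]; apply: dF; exact: lt_le_trans st.
have W : winding L c dc z = F (a + L) - F a.
  rewrite /winding -(Rintegral_periodic a L0 ck.2 fp).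
  by rewrite (Rintegral_primitive _ cf (dFr a (a + L) aa1)) ?lerDl ?(ltW L0).
pose h t := arg_cut (u t) (v t).
have dh t : a < t < a + L -> is_derive t 1 h (f t).
  move=> taL.
  have uv : v t != 0 \/ u t < 0.
    case: (eqVneq (v t) 0) => [v0|]; [right|by left].
    rewrite /u ReB subr_lt0; apply: single => //.
    by apply/eqP; rewrite -subr_eq0 -ImB; apply/eqP.
  have [hu hv] := is_cderive_curveB hc z t.
  apply: (is_derive_eq (is_derive_arg_cut uv hu hv)).
  rewrite /f ImM ReV ImV -/(u t) -/(v t); ring.
have hp t : h (t + L) = h t by rewrite /h /u /v p.
have uca : 0 < u a by rewrite /u ReB subr_gt0.
have dF' t : a <= t -> {for t, continuous F}.
  by move=> at_; apply: is_derive_continuous; apply: dF; exact: lt_le_trans at_.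
have [d1 d10 hd1] := continuous_dist_lt (cu a) uca.
have [d2 d20 hd2] := continuous_dist_lt (dF' a (lexx a)) ltr01.
have aaL : a <= a + L by rewrite lerDl ltW.
have [d3 d30 hd3] := continuous_dist_lt (dF' (a + L) aaL) ltr01.
(* Halving the minimum keeps [d] strictly below each bound: [d1] keeps the curve to the right of
   [z], [d2] and [d3] keep [F] within [1] of its end values, [eta] provides the change of side, and
   [L] gives [a + d <= a + L - d]. *)
pose d := Num.min (Num.min (Num.min d1 d2) (Num.min d3 eta)) L / 2.
have d0 : 0 < d by rewrite divr_gt0 // !lt_min d10 d20 d30 eta0 L0.
have dd : d < Num.min (Num.min (Num.min d1 d2) (Num.min d3 eta)) L.
  by rewrite /d ltr_pdivrMr // ltr_pMr ?ltr1n // -(pmulr_lgt0 _ (_ : 0 < 2^-1)) ?invr_gt0.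
move: (dd); rewrite !lt_min => /andP[/andP[/andP[dd1 dd2] /andP[dd3 dd4]] dL].
have dL2 : d + d <= L.
  have -> : d + d = Num.min (Num.min (Num.min d1 d2) (Num.min d3 eta)) L.
    by rewrite /d -splitr.
  by rewrite ge_min lexx orbT.
have mid : a + d <= a + L - d by lra.
have eqFh : F (a + L - d) - F (a + d) = h (a - d) - h (a + d).
  rewrite -(hp (a - d)) [a - d + L]addrAC.
  have aad : a - 1 < a + d by lra.
  have dhr t : a + d <= t <= a + L - d -> is_derive t 1 h (f t).
    by move=> /andP[t1 t2]; apply: dh; apply/andP; split; lra.
  by rewrite -(Rintegral_primitive mid cf (dFr _ _ aad)) (Rintegral_primitive mid cf dhr).
have upos s : `|s| < d1 -> 0 < u (a + s).
  move=> sd; have := hd1 (a + s); rewrite addrAC subrr add0r => /(_ sd).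
  rewrite ltr_norml => /andP[+ _]; lra.
have gap : pi < `|h (a - d) - h (a + d)|.
  apply: arg_cut_gap; [|by apply: upos; rewrite gtr0_norm|].
    by apply: upos; rewrite normrN gtr0_norm.
  by rewrite mulrC /v !ImB; apply: crossing; rewrite d0.
apply/eqP => W0; move: gap; rewrite -eqFh.
have h2 := hd2 (a + d); have h3 := hd3 (a + L - d).
rewrite [a + d]addrC addrK gtr0_norm // in h2.
rewrite [a + L - d]addrC addrK normrN gtr0_norm // in h3.
have := h2 dd2; have := h3 dd3; rewrite !ltr_norml => /andP[k1 k2] /andP[k3 k4].
have := pi_ge2 R; move: W; rewrite W0 => W pi2 gap.
have : `|F (a + L - d) - F (a + d)| < 2.
  rewrite ltr_norml; apply/andP; split; move: W k1 k2 k3 k4;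
  rewrite ![- d + _]addrC ![d + _]addrC; lra.
by move=> /(lt_trans gap); lra.
Qed.

End simple_crossing.

(** * Parametrized plane curves *)

Section periodic.
Context {R : realType}.
Implicit Types (L t a : R).

Lemma periodic_int (T : Type) (f : R -> T) L : (forall t, f (t + L) = f t) ->
  forall (k : int) t, f (t + k%:~R * L) = f t.
Proof.
move=> p k t; have pn (n : nat) s : f (s + n%:R * L) = f s.
  elim: n s => [|n IH] s; first by rewrite mul0r addr0.
  by rewrite -natr1 mulrDl mul1r addrA p IH.
case: k => n; first exact: pn.
by rewrite NegzE mulrNz mulNr -(pn n.+1 (t - _)) -addrA addNr addr0.
Qed.

Lemma period_reduce L a t : 0 < L -> exists k : int, a <= t + k%:~R * L < a + L.
Proof.
move=> L0; exists (- Num.floor ((t - a) / L)).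
have /andP[h1 h2] := mem_rg1_floor ((t - a) / L).
rewrite mulrNz mulNr; move: h1 h2.
rewrite ler_pdivlMr // ltr_pdivrMr // ?intrD1 ?rmorphD ?mulrDl ?mul1r.
by move=> h1 h2; apply/andP; split; lra.
Qed.
End periodic.

Section plane_curves.
Context {R : realType}.
Local Notation Re := complex.Re.
Local Notation Im := complex.Im.
Variables (L : R) (gamma : R -> plane R) (Gamma G : set (plane R)).

Lemma derivable_plane (f : R -> plane R) (t : R) : derivable f t 1 ->
  is_cderive t (fun s => toC (f s)) (toC (derive1 f t)).
Proof.
move=> df; rewrite derive1E.
have h : h^-1 *: (f (h *: 1 + t) - f t) @[h --> 0^'] --> 'D_1 f t by exact: df.
have ndiff (g : R -> R) (l : R) :
    h^-1 *: (g (h *: 1 + t) - g t) @[h --> 0^'] --> l -> is_derive t 1 g l.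
  move=> gl; apply: DeriveDef; first by apply/cvg_ex; exists l; exact: gl.
  exact: cvg_lim gl.
split; apply: ndiff.
  exact: (cvg_comp _ fst h cvg_fst).
exact: (cvg_comp _ snd h cvg_snd).
Qed.

Lemma ccontinuous_plane (f : R -> plane R) : continuous f ->
  ccontinuous (fun t => toC (f t)).
Proof.
move=> cf; split=> t.
  by apply: (cvg_comp f fst (cf t)); exact: cvg_fst.
by apply: (cvg_comp f snd (cf t)); exact: cvg_snd.
Qed.

Lemma cdistE (z w : plane R) : cdist z w = Normc.normc (toC z - toC w).
Proof. by []. Qed.

Lemma toC_inj : injective (@toC R).
Proof. by move=> [a b] [a' b'] [-> ->]. Qed.

(** Translate both parameters by the multiple of [L] that brings [s] into [[0, L[]; then [t] lands
    either in [[0, L[] or one period higher, and injectivity on [[0, L[] applies. *)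
Lemma periodic_injective (s t : R) : jordan_parametrization L gamma Gamma ->
  s < t -> t < s + L -> gamma s != gamma t.
Proof.
move=> [L0 _ p inj _] st tsL; apply/eqP => e.
have [k /andP[s0 s1]] := period_reduce 0 s L0.
rewrite add0r in s1.
have pk := periodic_int p k.
move: e; rewrite -(pk s) -(pk t).
set s' := s + _ in s0 s1 *; set t' := t + _.
have [t1|t1] := ltP t' L.
  move/inj => h; have : s' = t'.
    by apply: h; rewrite in_itv /= ?s0 ?s1 ?t1 ?andbT //; rewrite /t' /s' in s0 *; lra.
  by rewrite /s' /t' => /addIr; lra.
have -> : gamma t' = gamma (t' - L) by rewrite -(p (t' - L)) subrK.
move/inj => h; have : s' = t' - L.
  apply: h; rewrite in_itv /= ?s0 ?s1 //; apply/andP; split.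
    by rewrite subr_ge0.
  by rewrite /t' /s' in s1 *; lra.
by rewrite /s' /t'; lra.
Qed.

(** Compactness: the distance to [gamma t0] attains its minimum on the remaining arc, and
    injectivity makes it positive. Hence a curve point close to [gamma t0] has a parameter close to
    [t0] modulo [L]. *)
Lemma curve_separated (t0 e : R) : jordan_parametrization L gamma Gamma -> 0 < e ->
  t0 + e <= t0 + L - e -> 
  exists2 r, 0 < r & forall t, t0 + e <= t <= t0 + L - e -> r <= cdist (gamma t) (gamma t0).
Proof.
move=> hj e0 eL; have [L0 cg p inj _] := hj.
have cd : continuous (fun t => cdist (gamma t) (gamma t0)).
  apply: continuous_normc.
  exact: (ccontinuousD (ccontinuous_plane cg) (ccontinuous_cst (- toC (gamma t0)))).
have [m mI mmin] := EVT_min eL (continuous_subspaceT cd).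
exists (cdist (gamma m) (gamma t0)) => [|t tI]; last by apply: mmin; rewrite in_itv.
rewrite lt_neqAle normc_ge0 andbT eq_sym; apply/eqP => /Normc.eq0_normc/eqP.
rewrite subr_eq0 => /eqP/toC_inj mt0.
move: mI; rewrite in_itv /= => /andP[m1 m2].
have /eqP : gamma t0 != gamma m by apply: periodic_injective => //; lra.
by rewrite mt0.
Qed.

Lemma C_smooth_curve (alpha : R) : jordan_parametrization L gamma Gamma ->
  C_smooth 2 alpha gamma ->
  closed_C1_curve L (fun t => toC (gamma t)) (fun t => toC (derive1 gamma t)).
Proof.
move=> [L0 cg p inj _] [sm _]; split => // [t||t]; last by rewrite p.
  by apply: derivable_plane; exact: (sm 0%N).
apply: ccontinuous_plane => t; apply/differentiable_continuous/derivable1_diffP.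
exact: (sm 1%N).
Qed.

Lemma lipschitz_arc_length (K a b : R) : a <= b ->
  (forall s t, a <= s -> s <= t -> t <= b -> cdist (gamma t) (gamma s) <= K * (t - s)) ->
  (arc_length gamma a b <= (K * (b - a))%:E)%E.
Proof.
move=> ab lip; apply: ge_ereal_sup => _ [s [ps ls] <-]; rewrite lee_fin /polygon_length.
have part : itv_partition a b s by split.
apply: (@le_trans _ _ (\sum_(0 <= n < size s)
    (K * nth b (a :: s) n.+1 - K * nth b (a :: s) n))).
  rewrite big_seq [leRHS]big_seq; apply: ler_sum => n; rewrite mem_index_iota => /= ns.
  rewrite -mulrBr; apply: lip.
  - by apply: itv_partition_nth_ge part; rewrite ltnS ltnW.
  - by apply: ltW; have /pathP/(_ n ns) := ps; exact.
  - by apply: (@itv_partition_nth_le _ _ a b s n.+1 _ part); rewrite ltnS.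
by rewrite telescope_sumr // (itv_partition_nth_size _ part) mulrBr.
Qed.

(** If the derivative vanished at [t0], both coordinates would be [1 / 4]-Lipschitz just after [t0],
    and the arc from [t0] to [t0 + d] would have length at most [d / 2] instead of [d]. *)
Lemma arclength_derive_neq0 (alpha t0 : R) : arclength_parametrization L gamma Gamma ->
  C_smooth 2 alpha gamma -> derive1 gamma t0 != (0, 0).
Proof.
move=> [hj hl] sm; have [L0 hd cdc p] := C_smooth_curve hj sm.
apply/eqP => e.
have e4 : (0 : R) < 1 / 4 by rewrite divr_gt0.
have [d1 d10 hd1] := continuous_dist_lt (cdc.1 t0) e4.
have [d2 d20 hd2] := continuous_dist_lt (cdc.2 t0) e4.
rewrite e /= in hd1 hd2.
pose d := Num.min d1 d2 / 2.
have d0 : 0 < d by rewrite divr_gt0 // lt_min d10.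
have dd : d < Num.min d1 d2 by rewrite /d ltr_pdivrMr // ltr_pMr ?ltr1n // lt_min d10.
move: dd; rewrite lt_min => /andP[dd1 dd2].
have lipc (f df : R -> R) : (forall t : R, is_derive t 1 f (df t)) ->
    (forall t, `|t - t0| < Num.min d1 d2 -> `|df t - 0| < 1 / 4) ->
    forall s t, t0 <= s -> s <= t -> t <= t0 + d -> `|f t - f s| <= 1 / 4 * (t - s).
  move=> hf hb s t t0s st td.
  have [|x xI ->] := MVT_segment st (fun x _ => hf x).
    by apply: continuous_subspaceT => y; exact: is_derive_continuous (hf y).
  move: xI; rewrite in_itv /= => /andP[sx xt].
  rewrite normrM (ger0_norm (_ : 0 <= t - s)) ?subr_ge0 // ler_wpM2r ?subr_ge0 //.
  apply: ltW; rewrite -[df x]subr0; apply: hb.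
  by rewrite lt_min ger0_norm; lra.
have : (arc_length gamma t0 (t0 + d) <= (1 / 2 * (t0 + d - t0))%:E)%E.
  apply: lipschitz_arc_length => [|s t t0s st td]; first by rewrite lerDl ltW.
  apply: le_trans (normc_le _) _; rewrite ReB ImB.
  have h1 := lipc _ _ (fun t => (hd t).1) _ s t t0s st td.
  have h2 := lipc _ _ (fun t => (hd t).2) _ s t t0s st td.
  have -> : 1 / 2 * (t - s) = 1 / 4 * (t - s) + 1 / 4 * (t - s) by field.
  apply: lerD.
    by apply: h1 => x; rewrite lt_min => /andP[xd _]; exact: hd1.
  by apply: h2 => x; rewrite lt_min => /andP[_ xd]; exact: hd2.
rewrite hl ?lerDl ?(ltW d0) // lee_fin; lra.
Qed.

End plane_curves.

(** * The winding number on the domain *)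

Lemma same_sign (R : realType) (a y : R) : `|y - a| < `|a| -> 0 < a * y.
Proof.
have [p0|n0] := ltP 0 a.
  by rewrite (gtr0_norm p0) ltr_norml => /andP[h _]; rewrite mulr_gt0 //; lra.
rewrite (ler0_norm n0) ltr_norml => /andP[h h'].
by rewrite -mulrNN mulr_gt0 //; lra.
Qed.

Section domain.
Context {R : realType}.
Local Notation Re := complex.Re.
Local Notation Im := complex.Im.
Variables (L : R) (gamma : R -> plane R) (Gamma G : set (plane R)).
Hypothesis hG : bounded_domain_with_boundary G Gamma.

Lemma domain_boundary_disjoint (z : plane R) : G z -> ~ Gamma z.
Proof.
case: hG => oG _ _ _ <- Gz [_]; apply.
by move: oG => /interior_id ->.
Qed.

(** [A] meets [G] in a relatively open set since [G] is open, and in a relatively closed one since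
    [closure G] exceeds [G] only by points of [Gamma]. *)
Lemma connected_sub_domain (A : set (plane R)) : connected A ->
  A `&` Gamma = set0 -> A `&` G !=set0 -> A `<=` G.
Proof.
case: hG => oG _ _ _ bG cA AG0 AG z Az.
suff : A `&` G = A by move=> e; have [] : (A `&` G) z by rewrite e.
apply: cA => //; first by exists G.
exists (closure G); first exact: closed_closure.
apply/seteqP; split=> w [Aw Gw]; split => //; first exact: subset_closure.
apply: contrapT => nGw; have : (A `&` Gamma) w.
  split => //; rewrite -bG; split => // /interior_subset //.
by rewrite AG0.
Qed.

Lemma boundary_in_closure (z : plane R) : Gamma z -> closure G z.
Proof. by case: hG => _ _ _ _ <- []. Qed.

Lemma norm_le_cdist (z w : plane R) (e : R) : cdist z w < e -> ball z e w.
Proof.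
move=> h; split => /=; apply: le_lt_trans h; rewrite /ball /= cdistE.
  by apply: le_trans (Re_le_normc _); rewrite ReB.
by apply: le_trans (Im_le_normc _); rewrite ImB.
Qed.

Lemma cdist_lt_ball (z w : plane R) (e : R) : ball z e w -> cdist w z < e + e.
Proof.
move=> [/= h1 h2]; rewrite cdistE; apply: le_lt_trans (normc_le _) _.
rewrite ReB ImB /=; apply: ltrD; rewrite distrC; [exact: h1|exact: h2].
Qed.

(* Otherwise the ray would be an unbounded connected subset of [G]. *)
Lemma ray_hits_boundary (z : plane R) : G z ->
  exists2 s : R, 0 < s & Gamma (z.1 + s, z.2).
Proof.
move=> Gz; apply: contrapT => nh.
have cr : continuous (fun s : R => (z.1 + s, z.2) : plane R).
  move=> s.
  have h1 : (fun s : R => z.1 + s) @ s --> z.1 + s.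
    by apply: cvgD; [exact: cvg_cst|exact: cvg_id].
  exact: (cvg_pair h1 (cvg_cst z.2)).
pose A := (fun s : R => (z.1 + s, z.2) : plane R) @` `[0, +oo[.
have AG : A `<=` G.
  apply: connected_sub_domain.
  - apply: connected_continuous_connected.
      apply/connected_intervalP; exact: interval_is_interval.
    exact: (continuous_subspaceT cr).
  - apply/seteqP; split => // _ [[s /= + <-] Gs].
    rewrite in_itv /= andbT le_eqVlt => /predU1P[s0|s0]; last by apply: nh; exists s.
    move: Gs; rewrite -s0 addr0 -surjective_pairing.
    exact: domain_boundary_disjoint.
  - exists z; split => //; exists 0; rewrite /= ?in_itv /= ?lexx //.
    by rewrite addr0 -surjective_pairing.
case: hG => _ _ _ bG _; have [M [_ hM]] := bG.
have := hM (M + 1) (_ : M < M + 1); rewrite ltrDl ltr01 => /(_ isT).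
pose s := `|M| + `|z.1| + 2.
move=> /(_ (z.1 + s, z.2)); have : G (z.1 + s, z.2).
  by apply: AG; exists s => //; rewrite /= in_itv /= andbT /s !addr_ge0.
move=> Gs /(_ Gs); rewrite /= prod_normE /= ge_max => /andP[+ _].
have h1 : - `|z.1| <= z.1 by rewrite lerNl -normrN ler_norm.
have h2 := ler_norm M; have h3 := ler_norm (z.1 + s).
by move=> h; rewrite /s in h h3; lra.
Qed.

Hypothesis hgamma : arclength_parametrization L gamma Gamma.
Variable alpha : R.
Hypothesis hsmooth : C_smooth 2 alpha gamma.

Local Notation c := (fun t => toC (gamma t)).
Local Notation dc := (fun t => toC (derive1 gamma t)).
Local Notation wind z := (winding L c dc (toC z)).

Let hj : jordan_parametrization L gamma Gamma := proj1 hgamma.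
Let hc : closed_C1_curve L c dc := C_smooth_curve hj hsmooth.

Lemma curve_in (t : R) : Gamma (gamma t).
Proof. by case: hj => _ _ _ _ <-; exists t. Qed.

Lemma curve_neq (z : plane R) (t : R) : G z -> toC (gamma t) != toC z.
Proof.
move=> Gz; apply/eqP => /toC_inj e.
by apply: (domain_boundary_disjoint Gz); rewrite -e; exact: curve_in.
Qed.

Lemma domain_dist (z : plane R) : G z -> exists2 d : R, 0 < d &
  ball z d `<=` G /\ forall t, d <= Normc.normc (toC (gamma t) - toC z).
Proof.
case: (hG) => oG _ _ _ _ Gz; have := oG z Gz.
move=> /nbhs_ballP[d /= d0 dG]; exists d => //; split => // t.
rewrite leNgt; apply/negP => h.
apply: (@domain_boundary_disjoint (gamma t) _ (curve_in t)).
by apply/dG/norm_le_cdist; rewrite /cdist -normcN opprB.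
Qed.

Lemma winding_near (z : plane R) : G z ->
  \forall w \near z, G w /\ wind w = wind z.
Proof.
move=> /domain_dist[d d0 [dG dt]].
apply/nbhs_ballP; exists (d / 2) => /=; first by rewrite divr_gt0.
move=> w zw; split; first by apply: dG; apply: le_ball zw; lra.
apply: (winding_locally_constant hc) => t.
apply: lt_le_trans (dt t).
by have := cdist_lt_ball zw; rewrite -splitr.
Qed.

(** By local constancy, the set where the value equals that at [z] and the set where it differs are
    both open; connectedness of [G] leaves only the first. *)
Lemma winding_constant (z w : plane R) : G z -> G w -> wind w = wind z.
Proof.
move=> Gz Gw; have [oG _ cG _ _] := hG.
have op (P : R -> Prop) : open [set v | G v /\ P (wind v)].
  move=> v [Gv Pv]; have := winding_near Gv; apply: filterS => u [Gu e] /=; rewrite e.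
  by split.
suff e : [set v | G v /\ wind v = wind z] = G.
  by have [] : [set v | G v /\ wind v = wind z] w by rewrite e.
apply: cG; first by exists z.
- exists [set v | G v /\ wind v = wind z]; first exact: (op (fun x => x = wind z)).
  by apply/seteqP; split => v //= [Gv ?].
- exists (~` [set v | G v /\ wind v <> wind z]).
    by apply: open_closedC; exact: (op (fun x => x <> wind z)).
  apply/seteqP; split => v /= [Gv]; first by move=> e; split => // -[].
  by move=> h; split => //; apply: contrapT => ne; apply: h.
Qed.

(* The tangent is vertical at a point of largest abscissa. *)
Lemma rightmost_point : exists t0 : R, (forall t, (gamma t).1 <= (gamma t0).1) /\
  exists eta sg : R, 0 < eta /\ forall s t, t0 - eta < s -> s < t -> t < t0 + eta ->
    0 < sg * ((gamma t).2 - (gamma s).2).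
Proof.
have [L0 hd cdc p] := hc.
have [|t0 t0I tmax] := @EVT_max R (fun t => (gamma t).1) 0 L (ltW L0).
  exact: (continuous_subspaceT (curve_continuous hc).1).
exists t0.
have mx t : (gamma t).1 <= (gamma t0).1.
  have [k /andP[k0 k1]] := period_reduce 0 t L0; rewrite add0r in k1.
  have [_ _ p' _ _] := hj; rewrite -(periodic_int p' k t); apply: tmax.
  by rewrite in_itv /= k0 ltW.
split => //.
have x0 : (derive1 gamma t0).1 = 0.
  have h : is_derive t0 1 (fun t => (gamma t).1) 0.
    apply: (@derive1_at_max R _ (t0 - 1) (t0 + 1)) => [|t _||t _].
    - lra.
    - by have [h _] := hd t; apply: ex_derive; exact: h.
    - by rewrite in_itv /=; apply/andP; split; lra.
    - exact: mx.
  have [h1 _] := hd t0.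
  by rewrite -[LHS](@derive_val _ _ _ _ _ _ _ h1) (@derive_val _ _ _ _ _ _ _ h).
(* Nonzero because the first coordinate of the derivative vanishes and the whole derivative does
   not. Its sign records whether the ordinate increases or decreases near [t0]. *)
set sg := (derive1 gamma t0).2.
have sg0 : sg != 0.
  apply: contraNneq (arclength_derive_neq0 t0 hgamma hsmooth) => e.
  by rewrite [derive1 gamma t0]surjective_pairing x0 -/sg e.
have e0 : 0 < `|sg| by rewrite normr_gt0.
have [d d0 hd'] := continuous_dist_lt (cdc.2 t0) e0.
exists d, sg; split => // s t s0 st t1.
have cy : {within `[s, t], continuous (fun t => (gamma t).2)}.
  exact: (continuous_subspaceT (curve_continuous hc).2).
have [x xI ->] := MVT_segment (ltW st) (fun x _ => (hd x).2) cy.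
rewrite mulrA mulr_gt0 ?subr_gt0 //.
move: xI; rewrite in_itv /= => /andP[sx xt].
have : `|x - t0| < d by rewrite ltr_norml; apply/andP; split; lra.
by move=> /hd' h; exact: same_sign h.
Qed.

(** A point [g] of [G] near the rightmost point [gamma t0] exists because [Gamma] lies in the
    closure of [G]. Every hit of the ray from [g] is so close to [gamma t0] that its parameter
    falls, modulo [L], in the window where the ordinate is strictly monotone. So the hit is unique
    and the curve changes side there. *)
Lemma winding_neq0 (z : plane R) : G z -> wind z != 0.
Proof.
move=> Gz; have [L0 hd cdc p] := hc.
have [t0 [mx [eta' [sg [eta'0 mono']]]]] := rightmost_point.
pose eta := Num.min eta' (L / 2).
have eta0 : 0 < eta by rewrite lt_min eta'0 divr_gt0.
have etaL : eta <= L / 2 by rewrite ge_min lexx orbT.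
have mono s t : t0 - eta < s -> s < t -> t < t0 + eta ->
    0 < sg * ((gamma t).2 - (gamma s).2).
  have e : eta <= eta' by rewrite ge_min lexx.
  by move=> *; apply: mono'; lra.
have [|r r0 sep] := curve_separated hj eta0 (_ : t0 + eta <= t0 + L - eta).
  lra.
have [g [Gg bg]] : G `&` ball (gamma t0) (r / 2) !=set0.
  apply: (boundary_in_closure (curve_in t0)).
  by apply: nbhsx_ballx; rewrite divr_gt0.
rewrite (winding_constant Gg Gz).
have [s0 s00 hit] := ray_hits_boundary Gg.
have [_ _ p' _ rg] := hj; move: hit; rewrite -rg => -[ta _ eta_].
have [k /andP[k0 k1]] := period_reduce (t0 - eta) ta L0.
set tb := ta + _ in k0 k1.
have etb : gamma tb = (g.1 + s0, g.2) by rewrite /tb (periodic_int p') eta_.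
(* Such a point has ordinate [g.2] and abscissa between [g.1] and the largest one, so it is within
   [r / 2] of [gamma t0] in sup norm, hence at Euclidean distance less than [r]. *)
have far t : (gamma t).2 = g.2 -> g.1 <= (gamma t).1 ->
    ~~ (t0 + eta <= t <= t0 + L - eta).
  move=> yt xt; apply/negP => /sep; apply/negP; rewrite -ltNge.
  rewrite [r]splitr; apply: cdist_lt_ball; split => /=; rewrite /ball /=.
    have := bg.1; rewrite /ball /= !ltr_norml => /andP[h1 h2].
    by have := mx t; move=> h3; apply/andP; split; lra.
  by rewrite yt; exact: bg.2.
have tb1 : tb < t0 + eta.
  rewrite ltNge; apply/negP => h.
  have := far tb; rewrite etb /= h /= => /(_ erefl).
  by rewrite lerDl (ltW s00) => /(_ isT); rewrite -ltNge; lra.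
have tb0 : t0 - eta < tb.
  rewrite lt_neqAle k0 andbT; apply/eqP => e.
  have := far (tb + L); rewrite p' etb /= lerDl (ltW s00) => /(_ erefl isT).
  by rewrite -e => /negP; apply; apply/andP; split; lra.
(* Keeps [tb - s] and [tb + s] inside the window of monotonicity. *)
pose et := Num.min (tb - (t0 - eta)) (t0 + eta - tb).
have et0 : 0 < et by rewrite lt_min !subr_gt0 tb0 tb1.
have y_neq s t : t0 - eta < s -> s < t -> t < t0 + eta -> (gamma s).2 <> (gamma t).2.
  by move=> h1 h2 h3 e; have := mono s t h1 h2 h3; rewrite e subrr mulr0 ltxx.
apply: (winding_simple_crossing hc (a := tb) (eta := et)) => //.
- by move=> t; exact: curve_neq.
- by rewrite etb.
- by rewrite etb /= ltrDl.
- move=> t /andP[t1 t2] /= yt; rewrite ltNge; apply/negP => xt.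
  have /= := far t yt xt; rewrite negb_and -!ltNge => /orP[h|h].
    by apply: (y_neq tb t) => //; rewrite etb yt.
  apply: (y_neq (t - L) tb); [lra|lra|lra|].
  by rewrite etb /= -yt -(p' (t - L)) subrK.
- move=> s /andP[s1]; rewrite lt_min => /andP[s2 s3].
  have h1 : 0 < sg * ((gamma (tb + s)).2 - (gamma tb).2) by apply: mono; lra.
  have h2 : 0 < sg * ((gamma tb).2 - (gamma (tb - s)).2) by apply: mono; lra.
  have e2 : (gamma tb).2 = g.2 by rewrite etb.
  move: h1 h2; rewrite e2 /=; set y1 := _ - g.2 => h1.
  rewrite -opprB; set y2 := _ - g.2 => h2.
  have := mulr_gt0 h1 h2; have -> : sg * y1 * (sg * - y2) = sg ^+ 2 * - (y1 * y2) by ring.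
  have sg2 : 0 < sg ^+ 2.
    rewrite lt_neqAle sqr_ge0 andbT eq_sym sqrf_eq0; apply/eqP => z0.
    by move: h1; rewrite z0 mul0r ltxx.
  by rewrite pmulr_rgt0 // oppr_gt0.
Qed.

End domain.

Section kernel_estimate.
Context {R : realType}.
Variables (L : R) (gamma : R -> plane R) (Gamma G : set (plane R)) (alpha : R).
Hypothesis hG : bounded_domain_with_boundary G Gamma.
Hypothesis hgamma : arclength_parametrization L gamma Gamma.
Hypothesis hsmooth : C_smooth 2 alpha gamma.

(* Cauchy's formula for [p ^+ 2]. *)
Lemma kernel_estimate : exists2 C : R, 0 < C &
  forall (p : {poly R[i]}) (z : plane R), G z ->
  Normc.normc p.[toC z] ^+ 2 <= C * \int[lebesgue_measure]_(t in `[0, L])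
    (Normc.normc p.[toC (gamma t)] ^+ 2 / cdist (gamma t) z).
Proof.
have hc := C_smooth_curve (proj1 hgamma) hsmooth.
have [L0 hd cdc p0] := hc.
(* One reference point makes the constant independent of [z]: the winding integral takes its value
   at [z0] on all of [G]. *)
have [z0 Gz0] : G !=set0 by case: hG.
have W0 := winding_neq0 hG hgamma hsmooth Gz0.
set W := winding _ _ _ _ in W0.
have [M _ dcM] := EVT_max (ltW L0) (continuous_subspaceT (continuous_normc cdc)).
(* A bound on the speed; the [+ 1] makes it strictly positive. *)
pose B := Normc.normc (toC (derive1 gamma M)) + 1.
have B0 : 0 < B by rewrite ltr_wpDl ?normc_ge0.
exists (2 * B / `|W|) => [|p z Gz]; first by rewrite divr_gt0 ?mulr_gt0 ?normr_gt0.
have cz t : toC (gamma t) != toC z by exact: curve_neq hG hgamma _ _ Gz.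
have := cauchy_estimate hc (p * p) cz.
rewrite (winding_constant hG hgamma hsmooth Gz0 Gz) -/W.
rewrite hornerM Normc.normcM -expr2 -ler_pdivlMr ?normr_gt0 // => /le_trans; apply.
set I1 := \int[_]_(_ in _) _; set I2 := \int[_]_(_ in _) _.
suff I12 : I1 <= B * I2.
  have -> : 2 * B / `|W| * I2 = 2 * (B * I2) / `|W| by rewrite !mulrA mulrAC.
  by rewrite ler_pM2r ?invr_gt0 ?normr_gt0 // ler_pM2l.
rewrite /I1 /I2 {I1 I2}.
have cgz : ccontinuous (fun t => toC (gamma t) - toC z).
  exact: ccontinuousD (curve_continuous hc) (ccontinuous_cst _).
have ck : continuous (fun t => Normc.normc p.[toC (gamma t)] ^+ 2 / cdist (gamma t) z).
  apply: continuous_mul.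
    exact/continuous_sqr/continuous_normc/ccontinuous_poly/(curve_continuous hc).
  apply: continuous_invr; first exact: continuous_normc cgz.
  move=> t; apply/eqP => /Normc.eq0_normc /eqP; rewrite subr_eq0.
  by apply/negP; exact: cz.
rewrite -RintegralZl //; last exact: continuous_integrable.
apply: le_Rintegral => //.
- apply: continuous_integrable; apply: continuous_normc.
  apply: ccontinuousM; first exact/ccontinuous_poly/(curve_continuous hc).
  exact: ccontinuous_kernel hc _ cz.
- by apply: continuous_integrable; apply: continuous_mul => // t; exact: cvg_cst.
- move=> t tI; rewrite hornerM !Normc.normcM Normc.normcV -expr2 [leRHS]mulrCA.
  rewrite ler_wpM2l ?sqr_ge0 // -/(cdist (gamma t) z) ler_wpM2r ?invr_ge0 ?normc_ge0 //.
  by rewrite /B (le_trans (dcM t _)) ?inE // lerDl.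
Qed.

End kernel_estimate.

(** * Orthogonal polynomials *)

Section orthogonalization.
Context {R : realType}.
Local Notation C := (R[i]).
Variable ip : {poly C} -> {poly C} -> C.
Hypothesis ipl : forall (a : C) p q r, ip (a *: p + q) r = a * ip p r + ip q r.
Hypothesis ipC : forall p q, ip q p = conjc (ip p q).
Hypothesis ip_gt0 : forall p, p != 0 -> 0 < ip p p.

Lemma ip0l p : ip 0 p = 0.
Proof.
have := ipl 1 0 0 p; rewrite scaler0 addr0 mul1r => /eqP.
by rewrite -subr_eq0 opprD addrA subrr sub0r oppr_eq0 => /eqP.
Qed.

Lemma ipDl p q r : ip (p + q) r = ip p r + ip q r.
Proof. by have := ipl 1 p q r; rewrite scale1r mul1r. Qed.

Lemma ipZl a p r : ip (a *: p) r = a * ip p r.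
Proof. by have := ipl a p 0 r; rewrite addr0 ip0l addr0. Qed.

Lemma ipDr p q r : ip r (p + q) = ip r p + ip r q.
Proof. by rewrite !(ipC _ r) ipDl rmorphD. Qed.

Lemma ipZr a p r : ip r (a *: p) = conjc a * ip r p.
Proof. by rewrite !(ipC _ r) ipZl rmorphM. Qed.

Lemma ip_sumr (I : Type) (s : seq I) (F : I -> {poly C}) r :
  ip r (\sum_(i <- s) F i) = \sum_(i <- s) ip r (F i).
Proof.
elim: s => [|i s IH]; first by rewrite !big_nil ipC ip0l conjc0.
by rewrite !big_cons ipDr IH.
Qed.

(** Gram-Schmidt as a double induction: strong induction on [n] supplies the monic polynomials of
    lower degree, and the inner induction on [m] extends orthogonality by one degree at a time. *)
Lemma monic_orthogonal n : exists P : {poly C},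
  [/\ P \is monic, size P = n.+1 &
      forall q : {poly C}, (size q <= n)%N -> ip P q = 0].
Proof.
elim/ltn_ind: n => n IHn.
suff h m : (m <= n)%N -> exists P : {poly C}, [/\ P \is monic, size P = n.+1 &
    forall q : {poly C}, (size q <= m)%N -> ip P q = 0] by exact: h (leqnn n).
elim: m => [_|m IHm mn].
  exists 'X^n; rewrite monicXn size_polyXn; split => // q.
  by rewrite leqn0 size_poly_eq0 => /eqP ->; rewrite ipC ip0l conjc0.
have [P [Pm Ps Po]] := IHm (ltnW mn).
have [Q [Qm Qs Qo]] := IHn m mn.
(* Chosen so that [P + a *: Q] is orthogonal to [Q]. Any [q] of size at most [m + 1] is a multiple
   of [Q] plus a polynomial of size at most [m], to which [P] and [Q] are both orthogonal
   already. *)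
pose a := - (ip P Q / ip Q Q).
have sa : (size (a *: Q) < size P)%N.
  by rewrite Ps ltnS (leq_trans (size_scale_leq _ _)) // Qs.
have Q0 : Q != 0 by rewrite -size_poly_eq0 Qs.
exists (P + a *: Q); split.
- by rewrite monicE lead_coefDl // -monicE.
- by rewrite size_polyDl.
- move=> q qm; pose b := q`_m; pose q' := q - b *: Q.
  have sq' : (size q' <= m)%N.
    apply/leq_sizeP => i mi; rewrite coefB coefZ.
    case: (eqVneq i m) => [->|im].
      have -> : Q`_m = 1 by move/monicP: Qm; rewrite lead_coefE Qs.
      by rewrite mulr1 subrr.
    have mi' : (m < i)%N by rewrite ltn_neqAle eq_sym im.
    by rewrite !nth_default ?Qs ?mulr0 ?subr0 // (leq_trans qm).
  have -> : q = b *: Q + q' by rewrite addrC subrK.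
  rewrite ipDr ipZr !ipDl !ipZl (Po q') // (Qo q') // mulr0 addr0 addr0.
  rewrite /a mulNr divfK ?subrr ?mulr0 //.
  by apply: lt0r_neq0; exact: ip_gt0.
Qed.

Lemma orthonormal_exists : exists p : nat -> {poly C},
  (forall n, size (p n) = n.+1 /\ 0 < lead_coef (p n)) /\
  (forall m n, ip (p m) (p n) = (m == n)%:R).
Proof.
have [P hP] := choice monic_orthogonal.
pose r n := complex.Re (ip (P n) (P n)).
have P0 n : P n != 0 by have [_ Ps _] := hP n; rewrite -size_poly_eq0 Ps.
have rE n : ip (P n) (P n) = ((r n)%:C)%C.
  by have := ip_gt0 (P0 n); rewrite ltcE /r; case: (ip _ _) => x y /= /andP[/eqP -> _].
have r0 n : 0 < r n by have := ip_gt0 (P0 n); rewrite rE ltcR.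
pose s n : C := (((Num.sqrt (r n))^-1)%:C)%C.
have s0 n : 0 < s n by rewrite ltcR invr_gt0 sqrtr_gt0.
exists (fun n => s n *: P n); split => [n|m n].
  have [Pm Ps _] := hP n; split; first by rewrite size_scale ?lt0r_neq0.
  by rewrite lead_coefZ (monicP Pm) mulr1.
rewrite ipZl ipZr conjc_real.
have [->|mn] := eqVneq m n.
  have e : (Num.sqrt (r n))^-1 * ((Num.sqrt (r n))^-1 * r n) = 1.
    rewrite -{3}(sqr_sqrtr (ltW (r0 n))) expr2 mulKf ?mulVf //;
    by rewrite lt0r_neq0 // sqrtr_gt0.
  by rewrite rE -!rmorphM /= e.
suff -> : ip (P m) (P n) = 0 by rewrite !mulr0.
have [_ Pms Pmo] := hP m; have [_ Pns Pno] := hP n.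
have [lt|gt] := ltnP m n; last by apply: Pmo; rewrite Pns ltn_neqAle eq_sym mn.
by rewrite ipC Pno ?conjc0 // Pms.
Qed.

Lemma mulc_conjc (z : C) : z * conjc z = ((Normc.normc z ^+ 2)%:C)%C.
Proof.
rewrite normc_sqr; case: z => x y /=.
by apply/eqP; rewrite eq_complex /=; apply/andP; split; apply/eqP; ring.
Qed.

Lemma normc_real (x : R) : Normc.normc (x%:C)%C = `|x|.
Proof. by rewrite normcE /= expr0n addr0 sqrtr_sqr. Qed.

(* Apply the bound to [q = \sum_i conjc (p i).[z] *: p i]. *)
Lemma bessel_evaluation (p : nat -> {poly C}) (z : C) (K : R) :
  (forall m n, ip (p m) (p n) = (m == n)%:R) ->
  (forall q, Normc.normc q.[z] ^+ 2 <= K * complex.Re (ip q q)) ->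
  forall n, \sum_(i < n) Normc.normc (p i).[z] ^+ 2 <= K.
Proof.
move=> on bd n; set S := \sum_(i < n) _.
pose q := \sum_(i < n) conjc (p i).[z] *: p i.
have qz : q.[z] = (S%:C)%C.
  rewrite /q horner_sum rmorph_sum; apply: eq_bigr => i _.
  by rewrite hornerZ mulrC mulc_conjc.
have qp (j : 'I_n) : ip q (p j) = conjc (p j).[z].
  rewrite ipC /q ip_sumr (bigD1 j) //= big1 => [|i ij].
    by rewrite addr0 ipZr on eqxx mulr1 conjcK.
  by rewrite ipZr on (_ : (j == i :> nat) = false) ?mulr0 //; apply/negbTE; rewrite eq_sym.
have qq : ip q q = (S%:C)%C.
  rewrite {2}/q ip_sumr rmorph_sum; apply: eq_bigr => i _.
  by rewrite ipZr qp conjcK mulc_conjc.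
have S0 : 0 <= S by apply: sumr_ge0 => i _; exact: sqr_ge0.
have := bd q; rewrite qz qq normc_real ger0_norm // [complex.Re _]/= expr2.
(* If [S = 0], dividing by [S] is impossible; [0 <= K] then comes from the bound applied to the
   constant polynomial [1]. *)
have [S00 _|Sn0] := eqVneq S 0; last first.
  by rewrite ler_pM2r // lt_neqAle eq_sym Sn0.
rewrite S00; have := bd 1; rewrite hornerC Normc.normc1 expr1n => h.
have : 0 < complex.Re (ip 1 1) by have := ip_gt0 (oner_neq0 _); rewrite ltcE => /andP[].
move=> i0; rewrite -(pmulr_lge0 _ i0); exact: le_trans h.
Qed.

End orthogonalization.

(** * The inner product of the arclength measure *)

Lemma integral_mrestr (d : measure_display) (T : measurableType d) (R : realType)
    (mu : {measure set T -> \bar R}) (D : set T) (mD : measurable D) (f : T -> \bar R) :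
  measurable_fun setT f -> (forall x, (0 <= f x)%E) ->
  (\int[mrestr mu mD]_x f x = \int[mu]_(x in D) f x)%E.
Proof.
move=> mf f0; rewrite -(setUv D) ge0_integral_setU //.
- rewrite [X in (_ + X)%E]null_set_integral; last 3 first.
  + exact: measurableC.
  + exact: measurable_funTS.
  + by change (mu (~` D `&` D) = 0%E); rewrite setICl measure0.
  rewrite adde0; apply: eq_measure_integral => A mA AD.
  by change (mu (A `&` D) = mu A); rewrite setIidl.
- exact: measurableC.
- exact: measurable_funTS.
- by apply/disj_set2P; rewrite setICr.
Qed.

Section arclength_inner.
Context {R : realType}.
Local Notation C := (R[i]).
Local Notation Re := complex.Re.
Local Notation Im := complex.Im.
Variables (L : R) (gamma : R -> plane R) (Gamma G : set (plane R)) (alpha : R).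
Hypothesis hgamma : arclength_parametrization L gamma Gamma.
Hypothesis hsmooth : C_smooth 2 alpha gamma.
Local Notation c := (fun t => toC (gamma t)).
Let hc : closed_C1_curve L c (fun t => toC (derive1 gamma t)) :=
  C_smooth_curve (proj1 hgamma) hsmooth.
Let L0 : 0 < L. Proof. by case: hc. Qed.

Definition cmeasurable (f : plane R -> C) :=
  measurable_fun setT (fun z => Re (f z)) /\ measurable_fun setT (fun z => Im (f z)).

Lemma cmeasurableD f g : cmeasurable f -> cmeasurable g ->
  cmeasurable (fun z => f z + g z).
Proof.
move=> [f1 f2] [g1 g2]; split.
  under eq_fun do rewrite ReD; exact: measurable_funD.
under eq_fun do rewrite ImD; exact: measurable_funD.
Qed.

Lemma cmeasurableM f g : cmeasurable f -> cmeasurable g ->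
  cmeasurable (fun z => f z * g z).
Proof.
move=> [f1 f2] [g1 g2]; split.
  under eq_fun do rewrite ReM; apply: measurable_funB; exact: measurable_funM.
under eq_fun do rewrite ImM; apply: measurable_funD; exact: measurable_funM.
Qed.

Lemma cmeasurable_cst a : cmeasurable (fun=> a).
Proof. by split; exact: measurable_cst. Qed.

Lemma cmeasurable_toC : cmeasurable (@toC R).
Proof. by split; [exact: measurable_fst|exact: measurable_snd]. Qed.

Lemma cmeasurable_peval (p : {poly C}) : cmeasurable (peval p).
Proof.
rewrite /peval; elim/poly_ind: p => [|p a IH].
  by under [X in cmeasurable X]eq_fun do rewrite horner0; exact: cmeasurable_cst.
under [X in cmeasurable X]eq_fun do rewrite hornerMXaddC.
exact: cmeasurableD (cmeasurableM IH cmeasurable_toC) (cmeasurable_cst _).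
Qed.

Lemma cmeasurable_conj f : cmeasurable f -> cmeasurable (fun z => conjc (f z)).
Proof.
move=> [f1 f2]; split.
  by rewrite [X in measurable_fun _ X](_ : _ = fun z => Re (f z)) //;
    apply/funext => z; case: (f z).
rewrite [X in measurable_fun _ X](_ : _ = fun z => - Im (f z)).
  exact: measurable_funN.
by apply/funext => z; case: (f z).
Qed.

Lemma measurable_normc f : cmeasurable f ->
  measurable_fun setT (fun z => Normc.normc (f z)).
Proof.
move=> [f1 f2]; under eq_fun do rewrite normcE.
apply: (@measurableT_comp _ _ _ _ _ _ (@Num.sqrt R)).
  by apply: continuous_measurable_fun; exact: sqrt_continuous.
by apply: measurable_funD; exact: measurable_funX.
Qed.

Let mgamma : measurable_fun [set: measurableTypeR R] (gamma : measurableTypeR R -> plane R)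
  := jordan_parametrization_measurable (proj1 hgamma).

(** Change of variables for the image measure; the null endpoint [L] is then added to reach a
    compact interval, on which continuous functions are integrable. *)
Lemma ge0_integral_arclength (f : plane R -> \bar R) :
  measurable_fun setT f -> (forall z, (0 <= f z)%E) ->
  (\int[arclength_measure hgamma]_z f z =
   \int[lebesgue_measure]_(t in `[0%R, L]) f (gamma t))%E.
Proof.
move=> mf f0.
transitivity (\int[mrestr (@lebesgue_measure R) (measurable_itv `[0%R, L[)]_t f (gamma t))%E.
  by rewrite -(preimage_setT gamma) -ge0_integral_pushforward.
rewrite integral_mrestr //; last exact: measurableT_comp.
apply: integral_itv_bndo_bndc; apply: measurable_funTS.
exact: measurableT_comp.
Qed.

Lemma Rintegral_arclength (f : plane R -> R) : measurable_fun setT f ->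
  Rintegral (arclength_measure hgamma) setT f =
  \int[lebesgue_measure]_(t in `[0, L]) f (gamma t).
Proof.
move=> mf; rewrite /Rintegral; congr fine; rewrite integralE [RHS]integralE.
have mf' : measurable_fun setT (EFin \o f) by exact: measurableT_comp.
have ep : (\int[arclength_measure hgamma]_z (EFin \o f)^\+ z =
    \int[lebesgue_measure]_(t in `[0%R, L]) (EFin \o f)^\+ (gamma t))%E.
  exact: ge0_integral_arclength (measurable_funepos mf') (funepos_ge0 _).
have en : (\int[arclength_measure hgamma]_z (EFin \o f)^\- z =
    \int[lebesgue_measure]_(t in `[0%R, L]) (EFin \o f)^\- (gamma t))%E.
  exact: ge0_integral_arclength (measurable_funeneg mf') (funeneg_ge0 _).
by rewrite [X in (X - _)%E]ep [X in (_ - X)%E]en; congr (_ - _)%E; apply: eq_integral => t _;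
  rewrite ?funeposE ?funenegE.
Qed.

Definition arc_inner (p q : {poly C}) : C :=
  inner (arclength_measure hgamma) (peval p) (peval q).

Definition curve_integral (f : R -> C) : C :=
  Complex (\int[lebesgue_measure]_(t in `[0, L]) Re (f t))
          (\int[lebesgue_measure]_(t in `[0, L]) Im (f t)).

Lemma arc_innerE p q :
  arc_inner p q = curve_integral (fun t => p.[c t] * conjc q.[c t]).
Proof.
rewrite /arc_inner /inner /cintegral /curve_integral.
have [m1 m2] := cmeasurableM (cmeasurable_peval p) (cmeasurable_conj (cmeasurable_peval q)).
by rewrite !Rintegral_arclength.
Qed.

Lemma ccontinuous_conj (f : R -> C) : ccontinuous f -> ccontinuous (fun t => conjc (f t)).
Proof.
move=> [f1 f2]; split.
  by under [X in continuous X]eq_fun => t do [rewrite (_ : Re _ = Re (f t)); last by case: (f t)].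
under [X in continuous X]eq_fun => t do [rewrite (_ : Im _ = - Im (f t)); last by case: (f t)].
exact: continuous_opp.
Qed.

Lemma curve_integralD f g : ccontinuous f -> ccontinuous g ->
  curve_integral (fun t => f t + g t) = curve_integral f + curve_integral g.
Proof.
move=> [f1 f2] [g1 g2]; rewrite /curve_integral.
under eq_Rintegral do rewrite ReD.
under [in X in Complex _ X]eq_Rintegral do rewrite ImD.
by rewrite !RintegralD //; apply: continuous_integrable.
Qed.

Lemma curve_integralZ a f : ccontinuous f ->
  curve_integral (fun t => a * f t) = a * curve_integral f.
Proof.
move=> [f1 f2]; case: a => x y; rewrite /curve_integral.
under eq_Rintegral do rewrite ReM /=.
under [in X in Complex _ X]eq_Rintegral do rewrite ImM /=.
have cZ k (g : R -> R) : continuous g -> continuous (fun t => k * g t).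
  by move=> cg; apply: continuous_mul cg => t; exact: cvg_cst.
rewrite RintegralB ?RintegralD //;
  try by apply: continuous_integrable; exact: cZ.
rewrite !RintegralZl //; try exact: continuous_integrable.
Qed.

Let cc (p : {poly C}) : ccontinuous (fun t => p.[c t]).
Proof. exact: ccontinuous_poly (curve_continuous hc). Qed.

Lemma arc_inner_linear a p q r :
  arc_inner (a *: p + q) r = a * arc_inner p r + arc_inner q r.
Proof.
rewrite !arc_innerE.
have cr := ccontinuous_conj (cc r).
rewrite -curve_integralZ; last exact: ccontinuousM (cc p) cr.
rewrite -curve_integralD; last exact: ccontinuousM (cc q) cr.
  congr curve_integral; apply/funext => t.
  by rewrite hornerD hornerZ mulrDl mulrA.
exact: ccontinuousM (ccontinuous_cst _) (ccontinuousM (cc p) cr).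
Qed.

Lemma arc_innerC p q : arc_inner q p = conjc (arc_inner p q).
Proof.
have [f1 f2] := ccontinuousM (cc p) (ccontinuous_conj (cc q)).
rewrite !arc_innerE /curve_integral /= -mulN1r -RintegralZl //; last first.
  exact: continuous_integrable.
congr Complex; apply: eq_Rintegral => t _; rewrite ?ReM ?ImM;
  case: (p.[c t]) => x y; case: (q.[c t]) => u v /=; ring.
Qed.

Lemma arc_inner_sqr p : arc_inner p p =
  ((\int[lebesgue_measure]_(t in `[0, L]) Normc.normc p.[c t] ^+ 2)%:C)%C.
Proof.
rewrite arc_innerE /curve_integral; congr Complex.
  by apply: eq_Rintegral => t _; rewrite mulc_conjc.
transitivity (\int[lebesgue_measure]_(t in `[0, L]) (0 : R)); last first.
  by rewrite Rintegral_cst // mul0r.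
by apply: eq_Rintegral => t _; rewrite mulc_conjc.
Qed.

(** By the mean value theorem, a primitive gains a positive amount on a short interval [[t, t + e]]
    where [f] stays positive, and loses nothing on the two remaining pieces. *)
Lemma Rintegral_continuous_gt0 (f : R -> R) (t : R) : continuous f -> (forall s, 0 <= f s) ->
  0 < t < L -> 0 < f t -> 0 < \int[lebesgue_measure]_(s in `[0, L]) f s.
Proof.
move=> cf f0 /andP[t0 tL] ft.
have [d d0 hd] := continuous_dist_lt (cf t) ft.
have [F dF] := primitive_exists (-1) cf.
have dF' (s : R) : 0 <= s -> is_derive s 1 F (f s).
  by move=> s0; apply: dF; exact: lt_le_trans s0.
have inc (a b : R) : 0 <= a -> a <= b -> exists2 x, a <= x <= b & F b - F a = f x * (b - a).
  move=> a0 ab.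
  have [x xab||x xab e] := @MVT_segment R F f a b ab.
  - by apply: dF'; move: xab; rewrite in_itv /= => /andP[/ltW/(le_trans a0)].
  - apply: continuous_in_subspaceT => y /set_mem /=; rewrite in_itv /= => /andP[ay _].
    exact: is_derive_continuous (dF' y (le_trans a0 ay)).
  - by exists x => //; move: xab; rewrite in_itv.
have dFI (s : R) : 0 <= s <= L -> is_derive s 1 F (f s).
  by move=> /andP[s0 _]; exact: dF'.
rewrite (Rintegral_primitive (ltW (lt_trans t0 tL)) cf dFI).
pose e := Num.min (d / 2) (L - t).
have e0 : 0 < e by rewrite lt_min divr_gt0 //= subr_gt0.
have ed : e < d by rewrite gt_min; apply/orP; left; lra.
have eL : t + e <= L by rewrite -lerBrDl ge_min lexx orbT.
have t0' := ltW t0; have te : t <= t + e by lra.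
have [x1 _ h1] := inc 0 t (lexx _) t0'.
have [x2 /andP[x2t x2e] h2] := inc t (t + e) t0' te.
have [x3 _ h3] := inc (t + e) L (le_trans t0' te) eL.
have -> : F L - F 0 = (F L - F (t + e)) + (F (t + e) - F t) + (F t - F 0) by ring.
rewrite h1 h2 h3.
have fx2 : 0 < f x2.
  have /hd : `|x2 - t| < d by rewrite ger0_norm; lra.
  by rewrite ltr_norml => /andP[h _]; lra.
apply: ltr_wpDr; first by rewrite mulr_ge0 // subr_ge0.
apply: ltr_wpDl; first by rewrite mulr_ge0 // subr_ge0.
by rewrite mulr_gt0 //; lra.
Qed.

Lemma arc_inner_gt0 p : p != 0 -> 0 < arc_inner p p.
Proof.
move=> p0; rewrite arc_inner_sqr ltcR.
have [t t0L pt] : exists2 t : R, 0 < t < L & p.[c t] != 0.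
  apply: contrapT => np.
  (* These are [n] parameters strictly inside the period with distinct images on the curve, while a
     nonzero polynomial of size [n] has fewer than [n] roots. *)
  pose n := size p; pose t (i : 'I_n) : R := L * i.+1%:R / n.+1%:R.
  have tI i : 0 < t i < L.
    rewrite divr_gt0 ?mulr_gt0 //= /t -mulrA gtr_pMr // ltr_pdivrMr // mul1r ltr_nat.
    by rewrite ltnS.
  have ct_inj : injective (fun i => c (t i)).
    move=> i j /toC_inj; have [_ _ _ inj _] := proj1 hgamma.
    move=> /inj h; have : t i = t j.
      by apply: h; rewrite in_itv /=;
        [have /andP[/ltW -> ->] := tI i|have /andP[/ltW -> ->] := tI j].
    rewrite /t => /mulIf; rewrite invr_eq0 pnatr_eq0 => /(_ isT).
    move=> /mulfI; rewrite lt0r_neq0 // => /(_ isT) /eqP.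
    by rewrite eqr_nat eqSS => /eqP /val_inj.
  have := @max_poly_roots _ p [seq c (t i) | i <- enum 'I_n] p0.
  rewrite size_map size_enum_ord map_inj_uniq ?enum_uniq // ltnn => h.
  suff : false by []. apply: h => //.
  apply/allP => _ /mapP[i _ ->]; apply/rootP; apply: contrapT => pi.
  by apply: np; exists (t i) => //; apply/eqP.
apply: (Rintegral_continuous_gt0 _ _ t0L); last 2 first.
- by move=> s; exact: sqr_ge0.
- rewrite exprn_gt0 // lt_neqAle normc_ge0 andbT eq_sym.
  by apply: contra pt => /eqP/Normc.eq0_normc ->.
- exact/continuous_sqr/continuous_normc.
Qed.

End arclength_inner.

(** * The Cauchy kernel and the area measure *)

Section finite_tonelli.
Local Open Scope ereal_scope.
Context (d1 d2 : measure_display) (T1 : measurableType d1) (T2 : measurableType d2)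
  (R : realType).
Variables (m1 : {measure set T1 -> \bar R}) (m2 : {measure set T2 -> \bar R}).
Hypotheses (fin1 : m1 setT < +oo) (fin2 : m2 setT < +oo).
Variable f : T1 * T2 -> \bar R.
Hypotheses (mf : measurable_fun setT f) (f0 : forall x, 0 <= f x).

(** Finiteness is given as a proposition; restricting to [setT] turns it into the finite-measure
    structure under which Tonelli's theorem applies, with the same integrals. *)
Let n1 : {finite_measure set T1 -> \bar R} := mfrestr measurableT fin1.
Let n2 : {finite_measure set T2 -> \bar R} := mfrestr measurableT fin2.

Let nE1 (g : T1 -> \bar R) : \int[m1]_x g x = \int[n1]_x g x.
Proof.
apply: eq_measure_integral => A _ _.
by change (m1 A = m1 (A `&` setT)); rewrite setIT.
Qed.

Let nE2 (g : T2 -> \bar R) : \int[m2]_x g x = \int[n2]_x g x.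
Proof.
apply: eq_measure_integral => A _ _.
by change (m2 A = m2 (A `&` setT)); rewrite setIT.
Qed.

Lemma finite_tonelli :
  \int[m1]_x \int[m2]_y f (x, y) = \int[m2]_y \int[m1]_x f (x, y).
Proof.
rewrite nE1 nE2; under eq_integral do rewrite nE2.
under [RHS]eq_integral do rewrite nE1.
exact: fubini_tonelli.
Qed.

Lemma measurable_finite_tonelli :
  measurable_fun setT (fun y => \int[m1]_x f (x, y)).
Proof.
under eq_fun do rewrite nE1.
exact: (measurable_fun_fubini_tonelli_G (m1 := n1)).
Qed.

End finite_tonelli.

(** * A majorant of the kernel built from squares *)

Section dyadic_kernel.
Context {R : realType}.
Variables (G Gamma : set (plane R)).
Hypothesis hG : bounded_domain_with_boundary G Gamma.
Local Notation A := (area_measure hG).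

Lemma ball_plane (z : plane R) (r : R) : ball z r = ball z.1 r `*` ball z.2 r.
Proof. by []. Qed.

Lemma area_ball (z : plane R) (r : R) : 0 <= r ->
  (A (ball z r) <= ((r *+ 2) * (r *+ 2))%:E)%E.
Proof.
move=> r0.
have mb (x : R) : measurable (ball x r : set (measurableTypeR R)).
  exact: measurable_ball.
apply: (@le_trans _ _ ((@lebesgue_measure R \x @lebesgue_measure R)%E (ball z r))).
  change ((@lebesgue_measure R \x @lebesgue_measure R)%E (ball z r `&` G) <=
    (@lebesgue_measure R \x @lebesgue_measure R)%E (ball z r))%E.
  apply: le_measure; rewrite ?inE; last by move=> w [].
    apply: measurableI; last exact: bounded_domain_measurable hG.
    by rewrite ball_plane; exact: measurableX.
  by rewrite ball_plane; exact: measurableX.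
have lb (x : R) : (@lebesgue_measure R (ball x r) <= (r *+ 2)%:E)%E.
  by rewrite lebesgue_measure_ball.
rewrite ball_plane (product_measure1E _ _ (mb z.1) (mb z.2)) EFinM.
apply: lee_pmul; [exact: measure_ge0|exact: measure_ge0| |].
  exact: lb z.1.
exact: lb z.2.
Qed.

Lemma area_finite : (A setT < +oo)%E.
Proof.
have [_ _ _ [M [_ hM]] _] := hG.
have GM : G `<=` ball (0, 0) (`|M| + 2).
  move=> z Gz; have := hM (`|M| + 1) _ z Gz.
  rewrite (le_lt_trans (ler_norm M)) ?ltrDl // => /(_ isT) /= h.
  move: h; rewrite prod_normE ge_max => /andP[h1 h2].
  by split; rewrite /ball /= sub0r normrN; lra.
have -> : A setT = A (ball (0, 0) (`|M| + 2)).
  change ((@lebesgue_measure R \x @lebesgue_measure R)%E (setT `&` G) =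
    (@lebesgue_measure R \x @lebesgue_measure R)%E (ball (0, 0) (`|M| + 2) `&` G)).
  by rewrite setTI setIidr.
by apply: le_lt_trans (area_ball _ _) _; rewrite ?ltry ?addr_ge0.
Qed.

(* On the shell of sup-distance [2^-(k + 1)] to [2^-k] the kernel [1 / |w - z|]
   is at most [2^(k + 1)]. *)
Definition dyadic_kernel (J : nat) (x : plane R * plane R) : \bar R :=
  (\sum_(0 <= j <oo) (2 ^+ (J + j).+1 *
     \1_[set y : plane R * plane R | ball y.1 (2 ^- (J + j)) y.2] x)%:E)%E.

Lemma dyadic_kernel_term_ge0 J j (x : plane R * plane R) :
  (0 <= (2 ^+ (J + j).+1 *
     \1_[set y : plane R * plane R | ball y.1 (2 ^- (J + j)) y.2] x)%:E :> \bar R)%E.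
Proof. by rewrite lee_fin mulr_ge0 ?exprn_ge0 // indicE. Qed.

Lemma dyadic_kernel_ge0 J x : (0 <= dyadic_kernel J x)%E.
Proof. by apply: nneseries_ge0 => j _ _; exact: dyadic_kernel_term_ge0. Qed.

Lemma measurable_ball_diag (r : R) :
  measurable [set y : plane R * plane R | ball y.1 r y.2].
Proof.
have h (g : plane R -> R) : measurable_fun setT g ->
    measurable [set y : plane R * plane R | ball (g y.1) r (g y.2)].
  move=> mg; have mh : measurable_fun setT (fun y : plane R * plane R => g y.1 - g y.2).
    apply: measurable_funB; apply: measurableT_comp => //.
  have := mh measurableT (ball 0 r) (measurable_ball _ _).
  rewrite setTI; congr measurable; apply/seteqP; split => y;
  by rewrite /ball /= sub0r normrN.
rewrite (_ : [set _ | _] = [set y | ball (fst y.1) r (fst y.2)] `&`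
  [set y | ball (snd y.1) r (snd y.2)]); last by [].
by apply: measurableI; apply: h; [exact: measurable_fst|exact: measurable_snd].
Qed.

Lemma measurable_dyadic_kernel J : measurable_fun setT (dyadic_kernel J).
Proof.
apply: ge0_emeasurable_sum => [j x _ _|j _]; first exact: dyadic_kernel_term_ge0.
apply: measurableT_comp => //; apply: measurable_funM => //.
by apply: measurable_indic; exact: measurable_ball_diag.
Qed.

(** A sup-norm ball of radius [2^-k] is a square of area [4 * 4^-k], so the term of weight
    [2^(k + 1)] contributes at most [8 * 2^-k]. Summing over [k >= J] gives [16 * 2^-J], whatever
    the point [w]. *)
Lemma integral_dyadic_kernel J (w : plane R) :
  (\int[A]_z dyadic_kernel J (w, z) <= (16 * 2 ^- J)%:E)%E.
Proof.
have mb j : measurable (ball w (2 ^- (J + j)) : set (plane R)).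
  by rewrite ball_plane; apply: measurableX; exact: measurable_ball.
rewrite /dyadic_kernel integral_nneseries //; last first.
- move=> j; apply: measurableT_comp => //; apply: measurable_funM => //.
  exact: (measurable_indic (mb j)).
have e0 : 0 <= 16 * 2 ^- J :> R by rewrite mulr_ge0 // invr_ge0 exprn_ge0.
apply: le_trans (epsilon_trick0 xpredT e0).
apply: lee_nneseries => [j _ _|j _].
  by apply: integral_ge0 => z _; exact: dyadic_kernel_term_ge0.
under eq_integral do rewrite EFinM.
have e (z : plane R) : \1_[set y : plane R * plane R | ball y.1 (2 ^- (J + j)) y.2] (w, z)
    = \1_(ball w (2 ^- (J + j))) z :> R by [].
under eq_integral do rewrite e.
rewrite ge0_integralZl_EFin ?exprn_ge0 //; last first.
  by apply: measurableT_comp => //; exact: (measurable_indic (mb j)).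
rewrite (integral_indic _ measurableT (mb j)) setIT.
apply: (@le_trans _ _ ((2 ^+ (J + j).+1)%:E *
    ((2 ^- (J + j) *+ 2) * (2 ^- (J + j) *+ 2))%:E)%E).
  by rewrite lee_pmul2l ?lte_fin ?exprn_gt0 // area_ball // invr_ge0 exprn_ge0.
rewrite -EFinM lee_fin natrX [2 ^+ (J + j).+1]exprS [2 ^+ j.+1]exprS exprD.
have j0 : (2 : R) ^+ j != 0 by rewrite expf_neq0.
have J0 : (2 : R) ^+ J != 0 by rewrite expf_neq0.
rewrite (mulr2n (2 ^+ J * 2 ^+ j)^-1).
move: (2 ^+ j) (2 ^+ J) j0 J0 => x y x0 y0.
by rewrite le_eqVlt; apply/orP; left; apply/eqP; field; rewrite x0 y0.
Qed.

(** Outside the ball of radius [2^-J] the constant is enough. Inside, let [m] be the least exponent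
    whose ball misses [z]: the inverse distance is at most [2^m], and the term of index
    [m - 1 = J + j] equals exactly [2^m]. For [w = z] the inverse is [0] by convention. *)
Lemma inv_cdist_le J (w z : plane R) :
  (((cdist w z)^-1)%:E <= (2 ^+ J)%:E + dyadic_kernel J (w, z))%E.
Proof.
have K0 := dyadic_kernel_ge0 J (w, z).
have [->|d0] := eqVneq (cdist w z) 0.
  by rewrite invr0 adde_ge0 // lee_fin exprn_ge0.
have {}d0 : 0 < cdist w z by rewrite lt_neqAle eq_sym d0 normc_ge0.
have p0 k : 0 < 2 ^- k :> R by rewrite invr_gt0 exprn_gt0.
have far k : ~ ball w (2 ^- k) z -> (cdist w z)^-1 <= 2 ^+ k.
  move=> nb; rewrite -[leRHS]invrK lef_pV2 ?posrE // leNgt.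
  by apply/negP => h; apply: nb; exact: norm_le_cdist.
have [b|nb] := pselect (ball w (2 ^- J) z); last first.
  by rewrite -[leLHS]adde0 leeD // lee_fin; exact: far.
have [k hk] : exists k, ~ ball w (2 ^- k) z.
  (* Two copies of [2^-n] because the balls are sup-norm balls, in which the Euclidean distance to
     the centre can only be bounded through the sum of the two coordinates. *)
  have [n hn] : exists n, 2 ^- n + 2 ^- n <= cdist w z.
    have [n _ /(_ _ (leqnn n))] := near_infty_natSinv_expn_lt (PosNum d0).
    move=> h; exists n.+1; apply: ltW; rewrite exprS invfM -mulrDl.
    have -> : 2^-1 + 2^-1 = 1 :> R by field.
    by rewrite mul1r -div1r.
  exists n => /cdist_lt_ball; rewrite /cdist -normcN opprB -/(cdist w z).
  by rewrite ltNge hn.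
have ex : exists k, `[< ~ ball w (2 ^- k) z >] by exists k; apply/asboolP.
case: (ex_minnP ex) => m /asboolP hm mmin.
have Jm : (J < m)%N.
  rewrite ltnNge; apply/negP => mJ; apply: hm; apply: le_ball b.
  by rewrite lef_pV2 ?posrE ?exprn_gt0 // ler_eXn2l ?ltr1n.
have [j mE] : exists j, m = (J + j).+1.
  by exists (m - J.+1)%N; rewrite -addSn subnKC.
have bj : ball w (2 ^- (J + j)) z.
  apply: contrapT => nb; have : `[< ~ ball w (2 ^- (J + j)) z >] by apply/asboolP.
  by move=> /mmin; rewrite mE ltnn.
apply: (@le_trans _ _ (dyadic_kernel J (w, z))); last first.
  by rewrite -[leLHS]add0e leeD // lee_fin exprn_ge0.
apply: (@le_trans _ _ ((2 ^+ m)%:E)); first by rewrite lee_fin; exact: far.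
rewrite /dyadic_kernel.
apply: le_trans (nneseries_lim_ge j.+1 _); last first.
  by move=> i _ _; exact: dyadic_kernel_term_ge0.
rewrite big_nat_recr //= -[leLHS]add0e leeD //.
  by apply: sume_ge0 => i _; exact: dyadic_kernel_term_ge0.
by rewrite lee_fin indicE mem_set // mulr1 mE.
Qed.

End dyadic_kernel.

(** * Convergence *)

Section limit.
Context {R : realType}.
Local Notation C := (R[i]).
Variables (L : R) (gamma : R -> plane R) (Gamma G : set (plane R)) (alpha : R).
Hypothesis hG : bounded_domain_with_boundary G Gamma.
Hypothesis hgamma : arclength_parametrization L gamma Gamma.
Hypothesis hsmooth : C_smooth 2 alpha gamma.
Local Notation A := (area_measure hG).
Local Notation mu := (arclength_measure hgamma).
Let hc := C_smooth_curve (proj1 hgamma) hsmooth.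
Let L0 : 0 < L. Proof. by case: hc. Qed.

Lemma arclength_setT : mu setT = L%:E.
Proof.
change (@lebesgue_measure R (gamma @^-1` setT `&` `[0%R, L[%classic) = L%:E).
by rewrite preimage_setT setTI lebesgue_measure_itv /= lte_fin L0 oppr0 adde0.
Qed.

Lemma arclength_finite : (mu setT < +oo)%E.
Proof. by rewrite arclength_setT ltry. Qed.

Lemma measurable_sqr_peval (p : {poly C}) :
  measurable_fun setT (fun z => Normc.normc (peval p z) ^+ 2).
Proof.
apply: measurable_funX; apply: measurable_normc; exact: cmeasurable_peval.
Qed.

Lemma measurable_inv_cdist (z : plane R) : measurable_fun setT (fun w => (cdist w z)^-1).
Proof.
(* [powR] with exponent [-1] is measurable on the whole line and agrees with the inverse on
   nonnegative reals, including the value [0] at [0]. *)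
rewrite (_ : (fun w => _) = (@powR R ^~ (-1)) \o (fun w => cdist w z)); last first.
  by apply/funext => w /=; rewrite powR_inv1 ?normc_ge0.
apply: measurableT_comp; first exact: measurable_powR.
apply: (@measurable_normc _ (fun w => toC w - toC z)).
exact: cmeasurableD cmeasurable_toC (cmeasurable_cst (- toC z)).
Qed.

Lemma arc_inner_integral (p : {poly C}) :
  (\int[mu]_w (Normc.normc (peval p w) ^+ 2)%:E)%E = (complex.Re (arc_inner hgamma p p))%:E.
Proof.
rewrite (arc_inner_sqr hgamma) [complex.Re _]/=.
rewrite ge0_integral_arclength //; last 2 first.
- by apply: measurableT_comp => //; exact: measurable_sqr_peval.
- by move=> z; rewrite lee_fin sqr_ge0.
rewrite /Rintegral fineK //; apply: integrable_fin_num => //.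
apply: continuous_integrable; apply/continuous_sqr/continuous_normc.
exact: ccontinuous_poly (curve_continuous hc).
Qed.

Let csqr (q : {poly C}) : continuous (fun t => Normc.normc q.[toC (gamma t)] ^+ 2).
Proof.
by apply/continuous_sqr/continuous_normc; exact: ccontinuous_poly (curve_continuous hc).
Qed.

Let ckernel (q : {poly C}) (z : plane R) : G z ->
  continuous (fun t => Normc.normc q.[toC (gamma t)] ^+ 2 * (cdist (gamma t) z)^-1).
Proof.
move=> Gz; apply: continuous_mul; first exact: csqr.
apply: continuous_invr.
  by apply: continuous_normc; exact: ccontinuousD (curve_continuous hc) (ccontinuous_cst _).
move=> t; apply/eqP => /Normc.eq0_normc /eqP; rewrite subr_eq0.
by apply/negP; exact: curve_neq hG hgamma _ _ Gz.
Qed.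

Lemma kernel_estimate_integral : exists2 K : R, 0 < K &
  forall (p : {poly C}) (z : plane R), G z ->
  ((Normc.normc (peval p z) ^+ 2)%:E <=
  K%:E * \int[mu]_w (Normc.normc (peval p w) ^+ 2 * (cdist w z)^-1)%:E)%E.
Proof.
have [K K0 hK] := kernel_estimate hG hgamma hsmooth.
exists K => // p z Gz; have := hK p z Gz; rewrite -lee_fin => /le_trans; apply.
rewrite EFinM lee_pmul2l // ge0_integral_arclength //; last 2 first.
- apply: measurableT_comp => //; apply: measurable_funM.
    exact: measurable_sqr_peval.
  exact: measurable_inv_cdist.
- by move=> w; rewrite lee_fin mulr_ge0 ?sqr_ge0 ?invr_ge0 ?normc_ge0.
rewrite /Rintegral fineK //; apply: integrable_fin_num => //.
by apply: continuous_integrable; exact: ckernel.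
Qed.

(** A point of [G] has distance at least some [d > 0] to the curve, so the kernel is at most
    [1 / d]. The dependence of [K] on [z] is harmless, as Bessel's inequality is applied
    pointwise. *)
Lemma evaluation_bound (z : plane R) : G z -> exists K : R, forall q : {poly C},
  Normc.normc q.[toC z] ^+ 2 <= K * complex.Re (arc_inner hgamma q q).
Proof.
move=> Gz; have [K K0 hK] := kernel_estimate hG hgamma hsmooth.
have [d d0 [_ hd]] := domain_dist hG hgamma Gz.
exists (K / d) => q; apply: le_trans (hK q z Gz) _.
rewrite -mulrA ler_pM2l // (arc_inner_sqr hgamma) [complex.Re _]/=.
rewrite -RintegralZl //; last by apply: continuous_integrable; exact: csqr.
apply: le_Rintegral => //.
- by apply: continuous_integrable; exact: ckernel.
- apply: continuous_integrable; apply: continuous_mul; last exact: csqr.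
  by move=> t; exact: cvg_cst.
- move=> t _; rewrite mulrC ler_wpM2r ?sqr_ge0 //.
  by rewrite lef_pV2 ?posrE //; [exact: hd|exact: lt_le_trans d0 (hd t)].
Qed.

Lemma ae_domain : \forall z \ae A, G z.
Proof.
exists (~` G); split; last by move=> z.
  by apply: measurableC; exact: bounded_domain_measurable hG.
change ((@lebesgue_measure R \x @lebesgue_measure R)%E (~` G `&` G) = 0%E).
by rewrite setICl measure0.
Qed.

Variable p : nat -> {poly C}.
Hypothesis hp : orthonormal_polynomials mu p.

Let h n (z : plane R) : R := Normc.normc (peval (p n) z) ^+ 2.

Let h0 n z : 0 <= h n z. Proof. exact: sqr_ge0. Qed.

Let hon m n : arc_inner hgamma (p m) (p n) = (m == n)%:R.
Proof. by case: hp => _; exact. Qed.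

Let mh n : measurable_fun setT (fun z => (h n z)%:E).
Proof. by apply: measurableT_comp => //; exact: measurable_sqr_peval. Qed.

Let h1 n : (\int[mu]_w (h n w)%:E = 1)%E.
Proof. by rewrite arc_inner_integral hon eqxx. Qed.

Lemma orthonormal_cvg0 (z : plane R) : G z -> h n z @[n --> \oo] --> (0 : R).
Proof.
move=> /evaluation_bound[K hK].
have bes := bessel_evaluation (arc_inner_linear hgamma hsmooth)
  (arc_innerC hgamma hsmooth) (@arc_inner_gt0 _ _ _ _ _ hgamma hsmooth) hon hK.
apply: cvg_series_cvg_0; apply: nondecreasing_is_cvgn.
  by apply: nondecreasing_series => n _ _; exact: h0.
exists K => _ [n _ <-]; rewrite /series /= big_mkord; exact: bes.
Qed.

Let N (x : plane R * plane R) J n : \bar R := ((h n x.1)%:E * dyadic_kernel J x)%E.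

Let N0 x J n : (0 <= N x J n)%E.
Proof. by rewrite mule_ge0 ?lee_fin ?h0 ?dyadic_kernel_ge0. Qed.

Let mN J n : measurable_fun setT (fun x => N x J n).
Proof.
apply: emeasurable_funM; last exact: measurable_dyadic_kernel.
exact: (measurableT_comp (mh n) measurable_fst).
Qed.

(** The part of the kernel estimate at [z] that comes from the kernel above height [2^J]. *)
Let tail J n (z : plane R) : \bar R := (\int[mu]_w N (w, z) J n)%E.

Let tail0 J n z : (0 <= tail J n z)%E.
Proof. by apply: integral_ge0 => w _; exact: N0. Qed.

Let mtail J n : measurable_fun setT (tail J n).
Proof.
exact: (measurable_finite_tonelli arclength_finite (mN J n) (fun x => N0 x J n)).
Qed.

(** After exchanging the integrals, the inner one over [z] is at most [16 * 2^-J] for every [w], and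
    [h n] has total mass [1] on the curve. Hence the bound is independent of [n]. *)
Let integral_tail J n : (\int[A]_z tail J n z <= (16 * 2 ^- J)%:E)%E.
Proof.
rewrite -(finite_tonelli arclength_finite (area_finite hG) (mN J n) (fun x => N0 x J n)).
apply: (@le_trans _ _ (\int[mu]_w ((16 * 2 ^- J)%:E * (h n w)%:E))%E); last first.
  rewrite ge0_integralZl_EFin ?mulr_ge0 ?invr_ge0 ?exprn_ge0 //; last first.
    by move=> w _; rewrite lee_fin h0.
  by rewrite h1 mule1.
have mK (w : plane R) : measurable_fun setT (fun z => dyadic_kernel J (w, z)).
  exact: (measurable_fun_pair2 w (measurable_dyadic_kernel J)).
apply: ge0_le_integral; first exact: measurableT.
- by move=> w _; apply: integral_ge0 => z _; exact: N0.
(* The coordinates are swapped because [measurable_finite_tonelli] integrates out the first one,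
   here [z]. *)
- have mNs : measurable_fun setT (fun x : plane R * plane R => N (x.2, x.1) J n).
    apply: (measurableT_comp (mN J n)).
    by apply: measurable_fun_pair; [exact: measurable_snd|exact: measurable_fst].
  exact: (measurable_finite_tonelli (area_finite hG) mNs (fun x => N0 _ J n)).
- by apply: emeasurable_funM => //; exact: mh.
- move=> w _; rewrite /N /=.
  have K0 z : setT z -> (0 <= dyadic_kernel J (w, z))%E.
    by move=> _; exact: dyadic_kernel_ge0.
  rewrite (ge0_integralZl_EFin _ measurableT K0 (mK w)); last exact: h0.
  by rewrite muleC lee_wpmul2r ?lee_fin ?h0 // integral_dyadic_kernel.
Qed.

(** Where [h n z] exceeds [K * 2^J], the kernel estimate and [inv_cdist_le] bound it by [K * 2^J]
    plus the tail term, as [h n] has mass [1]; elsewhere the minimum is [h n z] itself. The minimum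
    is both bounded by a constant and pointwise below [h n z], as dominated convergence requires. *)
Let split_bound : exists2 K : R, 0 < K & forall J n z, G z ->
  ((h n z)%:E <= (Num.min (h n z) (K * 2 ^+ J))%:E + K%:E * tail J n z)%E.
Proof.
have [K K0 hK] := kernel_estimate_integral; exists K => // J n z Gz.
have Kt : (0 <= K%:E * tail J n z)%E.
  by apply: mule_ge0; [rewrite lee_fin ltW|exact: tail0].
have [hle|hgt] := leP (h n z) (K * 2 ^+ J); first by rewrite leeDl.
apply: le_trans (hK (p n) z Gz) _.
rewrite EFinM -ge0_muleDr; [|by rewrite lee_fin exprn_ge0|exact: tail0].
rewrite lee_pmul2l //.
rewrite -[(2 ^+ J)%:E]mule1 -(h1 n) -ge0_integralZl_EFin ?exprn_ge0 //; last first.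
  by move=> w _; rewrite lee_fin h0.
have g0 (w : plane R) : setT w -> (0 <= (2 ^+ J)%:E * (h n w)%:E)%E.
  by move=> _; apply: mule_ge0; rewrite lee_fin ?h0 ?exprn_ge0.
have mg : measurable_fun setT (fun w => (2 ^+ J)%:E * (h n w)%:E)%E.
  by apply: emeasurable_funM => //; exact: mh.
have t0 (w : plane R) : setT w -> (0 <= N (w, z) J n)%E by move=> _; exact: N0.
have mt : measurable_fun setT (fun w => N (w, z) J n).
  exact: (measurable_fun_pair1 z (mN J n)).
rewrite -(ge0_integralD _ measurableT g0 mg t0 mt).
apply: ge0_le_integral; first exact: measurableT.
- by move=> w _; rewrite lee_fin mulr_ge0 ?h0 ?invr_ge0 ?normc_ge0.
- apply: measurableT_comp => //; apply: measurable_funM.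
    exact: measurable_sqr_peval.
  exact: measurable_inv_cdist.
- exact: emeasurable_funD mg mt.
- move=> w _; rewrite /N /= EFinM [X in (_ <= X + _)%E]muleC -ge0_muleDr.
  + by rewrite lee_wpmul2l ?lee_fin ?h0 // inv_cdist_le.
  + by rewrite lee_fin exprn_ge0.
  + exact: dyadic_kernel_ge0.
Qed.

Lemma area_integral_small (e : R) : 0 < e ->
  \forall n \near \oo, (\int[A]_z (h n z)%:E <= e%:E)%E.
Proof.
move=> e0; have [K K0 hK] := split_bound.
(* [J] is fixed before [n]: the tails then take at most [e / 2] for every [n], leaving [e / 2] for
   the truncated functions. *)
have [J hJ] : exists J, K * (16 * 2 ^- J) <= e / 2.
  have q0 : 0 < e / 2 / (K * 16) by rewrite !divr_gt0 ?mulr_gt0.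
  have [n _ /(_ _ (leqnn n))] := near_infty_natSinv_expn_lt (PosNum q0).
  move=> /= /ltW qn; exists n; rewrite mulrA -ler_pdivlMl ?mulr_gt0 // mulrC.
  by rewrite -div1r.
pose f n z : \bar R := (Num.min (h n z) (K * 2 ^+ J))%:E.
have f0 n z : (0 <= f n z)%E.
  by rewrite lee_fin le_min h0 mulr_ge0 ?exprn_ge0 // ltW.
have mf n : measurable_fun setT (f n).
  apply: measurableT_comp => //; apply: measurable_minr => //.
  exact: measurable_sqr_peval.
have K2 : 0 <= K * 2 ^+ J by rewrite mulr_ge0 ?exprn_ge0 // ltW.
have fcvg : \forall z \ae A, setT z -> f n z @[n --> \oo] --> (cst 0%E : plane R -> \bar R) z.
  apply: filterS ae_domain => z Gz _; apply/fine_cvgP; split; first exact: nearW.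
  apply: (squeeze_cvgr _ (cvg_cst 0) (orthonormal_cvg0 Gz)).
  by apply: nearW => n /=; rewrite le_min h0 K2 ge_min lexx.
have ig : A.-integrable setT (cst (K * 2 ^+ J)%:E).
  apply/integrableP; split => //; rewrite integral_cst //= ger0_norm //.
  by rewrite lte_mul_pinfty // area_finite.
have fdom : \forall z \ae A, forall n, setT z -> (`|f n z| <= cst (K * 2 ^+ J)%:E z)%E.
  by apply: aeW => z n _; rewrite gee0_abs //= lee_fin ge_min lexx orbT.
have [_ _] := dominated_convergence measurableT mf (measurable_cst _) fcvg ig fdom.
rewrite integral0 => /fine_cvgP[ffin /cvgrPdist_le fsmall].
have e20 : 0 < e / 2 by rewrite divr_gt0.
apply: filterS2 ffin (fsmall _ e20) => n fn /=; rewrite sub0r normrN => fe.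
have fI : (\int[A]_z f n z <= (e / 2)%:E)%E.
  have fn' : (\int[A]_z f n z)%E \is a fin_num by exact: fn.
  by rewrite -(fineK fn') lee_fin (le_trans (ler_norm _)).
have mKt : measurable_fun setT (fun z => K%:E * tail J n z)%E.
  by apply: emeasurable_funM => //; exact: mtail.
have Kt0 z : (0 <= K%:E * tail J n z)%E.
  by apply: mule_ge0; [rewrite lee_fin ltW|exact: tail0].
apply: (@le_trans _ _ (\int[A]_z (f n z + K%:E * tail J n z))%E).
  apply: ae_ge0_le_integral => //.
  - by move=> z _; rewrite lee_fin h0.
  - by move=> z _; apply: adde_ge0.
  - exact: emeasurable_funD.
  - by apply: filterS ae_domain => z Gz _; exact: hK.
rewrite (ge0_integralD _ measurableT (fun z _ => f0 n z) (mf n) (fun z _ => Kt0 z) mKt).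
rewrite (ge0_integralZl_EFin _ measurableT (fun z _ => tail0 J n z) (mtail J n) (ltW K0)).
have -> : e = e / 2 + e / 2 by rewrite -splitr.
rewrite EFinD; apply: leeD => //.
apply: le_trans (_ : _ <= (K * (16 * 2 ^- J))%:E)%E _; last by rewrite lee_fin.
by rewrite EFinM lee_pmul2l // integral_tail.
Qed.

Lemma L2norm_cvg0 : L2norm A (peval (p n)) @[n --> \oo] --> 0%E.
Proof.
have LE n : L2norm A (peval (p n)) = ((\int[A]_z (h n z)%:E) `^ 2^-1)%E.
  rewrite /L2norm unlock /=; congr poweR; apply: eq_integral => z _ /=.
  by rewrite ger0_norm ?normc_ge0 // powR_mulrn ?normc_ge0.
have small (e : R) : 0 < e -> \forall n \near \oo, (L2norm A (peval (p n)) <= e%:E)%E.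
  move=> e0; have e2 : 0 < e ^+ 2 by rewrite exprn_gt0.
  apply: filterS (area_integral_small e2) => n hn; rewrite LE.
  have I0 : (0 <= \int[A]_z (h n z)%:E)%E.
    by apply: integral_ge0 => z _; rewrite lee_fin h0.
  apply: (@le_trans _ _ ((e ^+ 2)%:E `^ 2^-1)%E).
    apply: gt0_ler_poweR => //; rewrite in_itv /= leey andbT //.
    by rewrite lee_fin ltW.
  rewrite poweR12_sqrt; last by rewrite lee_fin ltW.
  by rewrite /= sqrtr_sqr gtr0_norm.
have N2 n : (0 <= L2norm A (peval (p n)))%E by rewrite /L2norm Lnorm_ge0.
apply/fine_cvgP; split.
  apply: filterS (small _ ltr01) => n n1.
  by rewrite ge0_fin_numE // (le_lt_trans n1) // ltry.
apply/cvgrPdist_le => e e0; apply: filterS (small _ e0) => n ne /=.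
rewrite sub0r normrN ger0_norm ?fine_ge0 //.
by rewrite -lee_fin fineK // ge0_fin_numE // (le_lt_trans ne) // ltry.
Qed.

End limit.

(** * Supports and conclusion *)

Section support.
Context {R : realType}.

(** A point outside the support has an open neighbourhood of measure zero, all of whose points are
    outside as well. *)
Lemma msupport_closed (mu : {measure set (plane R) -> \bar R}) : closed (msupport mu).
Proof.
rewrite -[msupport mu]setCK; apply: open_closedC; rewrite openE => z /= nz.
have [U [oU Uz mU]] : exists U, [/\ open U, U z & ~ (0 < mu U)%E].
  apply: contrapT => h; apply: nz => U oU Uz; apply: contrapT => mU.
  by apply: h; exists U.
have := oU z Uz; apply: filterS => w Uw sw.
exact: mU (sw U oU Uw).
Qed.

Lemma msupport_compact (mu : {measure set (plane R) -> \bar R}) (B : set (plane R)) :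
  compact B -> closed B -> mu (~` B) = 0%E -> compact (msupport mu).
Proof.
move=> kB cB mB; apply: (subclosed_compact _ kB); first exact: msupport_closed.
move=> z sz; apply: contrapT => nB.
by have := sz (~` B) (closed_openC cB) nB; rewrite mB ltxx.
Qed.

Variables (L : R) (gamma : R -> plane R) (Gamma G : set (plane R)).
Hypothesis hG : bounded_domain_with_boundary G Gamma.
Hypothesis hgamma : arclength_parametrization L gamma Gamma.
Local Notation A := (area_measure hG).
Local Notation mu := (arclength_measure hgamma).

Let L0 : 0 < L. Proof. by case: hgamma => -[]. Qed.
Let curveG t : Gamma (gamma t). Proof. by case: hgamma => -[_ _ _ _ <-] _; exists t. Qed.

Lemma bounding_box : exists B : set (plane R),
  [/\ compact B, closed B, G `<=` B & Gamma `<=` B].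
Proof.
have [_ _ _ [M [_ hM]] bG] := hG.
pose I := `[- (`|M| + 1), `|M| + 1]%classic : set R.
have kB : compact (I `*` I : set (plane R)).
  by apply: compact_setX; exact: segment_compact.
have cB : closed (I `*` I : set (plane R)).
  by apply: compact_closed => //; exact: (@norm_hausdorff R (R * R)%type).
have GB : G `<=` I `*` I.
  move=> z Gz; have := hM (`|M| + 1) _ z Gz.
  rewrite (le_lt_trans (ler_norm M)) ?ltrDl // => /(_ isT) /=.
  rewrite prod_normE ge_max !ler_norml => /andP[h1 h2].
  by split; rewrite /I /= in_itv /= ?h1 ?h2.
exists (I `*` I); split => //.
rewrite -bG => z [zG _].
by move/closure_id: cB => ->; exact: closure_subset zG.
Qed.

Lemma arclength_outside (B : set (plane R)) : Gamma `<=` B -> mu (~` B) = 0%E.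
Proof.
move=> GB; change (@lebesgue_measure R (gamma @^-1` (~` B) `&` `[0%R, L[%classic) = 0%E).
rewrite (_ : gamma @^-1` (~` B) `&` `[0%R, L[%classic = set0) ?measure0 //.
by apply/seteqP; split => // t [/= nB _]; apply: nB; exact: GB.
Qed.

Lemma area_outside (B : set (plane R)) : G `<=` B -> A (~` B) = 0%E.
Proof.
move=> GB; change ((@lebesgue_measure R \x @lebesgue_measure R)%E (~` B `&` G) = 0%E).
rewrite (_ : ~` B `&` G = set0) ?measure0 //.
by apply/seteqP; split => // t [/= nB Gt]; apply: nB; exact: GB.
Qed.

Lemma curve_sub_support : Gamma `<=` msupport mu.
Proof.
have [[_ cg p _ rg] _] := hgamma.
move=> z Gz; have [t _ tz] : range gamma z by rewrite rg.
move=> U oU; rewrite -tz => Ut.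
have [k /andP[k0 k1]] := period_reduce 0 t L0; rewrite add0r in k1.
rewrite -(periodic_int p k) in Ut; set s := t + _ in k0 k1 Ut.
have /nbhs_ballP[d /= d0 hd] : nbhs s (gamma @^-1` U) by exact: cg (oU _ Ut).
change (0 < @lebesgue_measure R (gamma @^-1` U `&` `[0%R, L[%classic))%E.
(* Since [s < L], there is room to the right of [s] for an interval of positive length inside both
   the period and the preimage of [U]. *)
pose e := Num.min d (L - s).
have e0 : 0 < e by rewrite lt_min d0 subr_gt0.
have eL : s + e <= L by rewrite -lerBrDl ge_min lexx orbT.
apply: (@lt_le_trans _ _ (@lebesgue_measure R `[s, s + e[%classic)).
  by rewrite lebesgue_measure_itv /= lte_fin ltrDl e0 -EFinD addrAC subrr add0r lte_fin.
apply: le_measure; rewrite ?inE; [exact: measurable_itv| |].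
  apply: measurableI; last exact: measurable_itv.
  rewrite -[X in measurable X]setTI.
  apply: (jordan_parametrization_measurable (proj1 hgamma)) => //.
  exact: open_measurable_plane.
move=> x /=; rewrite in_itv /= => /andP[sx xe]; split; last first.
  by rewrite /= in_itv /= (le_trans k0 sx) (lt_le_trans xe eL).
apply: hd; rewrite /ball /= distrC ger0_norm ?subr_ge0 // ltrBlDl.
by apply: lt_le_trans xe _; rewrite lerD2l ge_min lexx.
Qed.

Lemma curve_infinite (S : set (plane R)) : Gamma `<=` S -> infinite_set S.
Proof.
move=> GS fS; have [[_ _ _ inj _] _] := hgamma.
(* The shift [n + 2] keeps every parameter strictly below [L], where injectivity holds. *)
pose f (n : nat) := gamma (L / n.+2%:R).
apply: infinite_nat; apply: (sub_finite_set _ (finite_preimage _ fS : finite_set (f @^-1` S))).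
  by move=> n _; apply: GS; exact: curveG.
have fI n : L / n.+2%:R \in `[0, L[.
  rewrite in_itv /= divr_ge0 ?(ltW L0) //=.
  by rewrite ltr_pdivrMr // ltr_pMr // ltr1n.
move=> m n _ _ /inj => /(_ (fI _) (fI _)).
move=> /(mulfI (lt0r_neq0 L0)) /invr_inj /eqP.
by rewrite eqr_nat => /eqP [].
Qed.

Lemma area_gt0 : (0 < A setT)%E.
Proof.
have [oG [z Gz] _ _ _] := hG.
have /nbhs_ballP[d /= d0 dG] := oG z Gz.
have mb (x : R) : measurable (ball x d : set (measurableTypeR R)).
  exact: measurable_ball.
have lb (x : R) : (0 < @lebesgue_measure R (ball x d))%E.
  by rewrite lebesgue_measure_ball ?(ltW d0) // lte_fin mulrn_wgt0.
change (0 < (@lebesgue_measure R \x @lebesgue_measure R)%E (setT `&` G))%E.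
rewrite setTI.
apply: (@lt_le_trans _ _ ((@lebesgue_measure R \x @lebesgue_measure R)%E (ball z d))).
  rewrite ball_plane (product_measure1E _ _ (mb z.1) (mb z.2)).
  by apply: mule_gt0; [exact: lb z.1|exact: lb z.2].
apply: le_measure; rewrite ?inE //.
  by rewrite ball_plane; exact: measurableX.
exact: bounded_domain_measurable hG.
Qed.

End support.

Theorem proposition1p3 (R : realType) (alpha : R)
  (halpha : 1 / 2 < alpha) (halpha1 : alpha < 1)
  (L : R) (gamma : R -> plane R) (Gamma G : set (plane R))
  (hgamma : arclength_parametrization L gamma Gamma)
  (hsmooth : C_smooth 2 alpha gamma)
  (hG : bounded_domain_with_boundary G Gamma) :
  PS_perturbation
    (measure_add (arclength_measure hgamma) (area_measure hG))
    (arclength_measure hgamma) (area_measure hG).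
Proof.
have [B [kB cB GB CB]] := bounding_box hG.
pose mu0 : {measure set (plane R) -> \bar R} :=
  measure_add (arclength_measure hgamma) (area_measure hG).
have addE S : mu0 S = (arclength_measure hgamma S + area_measure hG S)%E.
  exact: measure_addE.
change (PS_perturbation mu0 (arclength_measure hgamma) (area_measure hG)).
have fin1 := arclength_finite hgamma hsmooth.
have fin2 := area_finite hG.
have out1 := arclength_outside hgamma CB.
have out2 := area_outside hG GB.
have sub1 := curve_sub_support hgamma.
split.
- split; split.
  + by rewrite addE lte_add_pinfty.
  + by apply: (msupport_compact kB cB); rewrite addE out1 out2 adde0.
  (* The sum dominates the arclength measure, so its support still contains the curve. *)
  + apply: (curve_infinite hgamma) => z /sub1 sz U oU Uz.
    by rewrite addE; apply: lt_le_trans (sz U oU Uz) _; rewrite leeDl // measure_ge0.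
  + exact: fin1.
  + exact: msupport_compact kB cB out1.
  + by apply: (curve_infinite hgamma) => z /sub1.
- by move=> S _; exact: addE.
- by exists setT => //; rewrite gt_eqF // area_gt0.
- have [p [hp hon]] := orthonormal_exists (arc_inner_linear hgamma hsmooth)
    (arc_innerC hgamma hsmooth) (@arc_inner_gt0 _ _ _ _ _ hgamma hsmooth).
  by exists p.
- by move=> p hp; exact: (L2norm_cvg0 hG hsmooth hp).
Qed.
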